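(* Let $L$ be a $\mathrm{gl}$-regular Nijenhuis operator on a manifold $\mathsf M$ of dimension $n$, let $M_1,\dots,M_n$ be a basis of $\mathrm{Sym}\,L$, and write $$M_i=c^i_1L^{n-1}+\dots+c^i_n\mathrm{Id}.$$ The functions $c^i_j$ form an invertible matrix $\mathcal C=(c^i_j)$ ($i$ the row index, $j$ the column index); denote $\mathcal C^{-1}=\widetilde{\mathcal C}=(\widetilde c\,^i_j)$. Let $A_1=\mathrm{Id}$ and $A_i=LA_{i-1}-\sigma_{i-1}\mathrm{Id}$ for $i=2,\dots,n$, where $\det(t\,\mathrm{Id}-L)=t^n-\sigma_1t^{n-1}-\dots-\sigma_n$, and consider the operator fields $R_j=\widetilde c\,^1_jA_1+\dots+\widetilde c\,^n_jA_n$, $j=1,\dots,n$. Let $\mathrm d f$ be a regular conservation law of $L$, $\check P$ the corresponding operator (see context), and let $\bar h_1,\dots,\bar h_n$ be the functions on $T^*\mathsf M$ defined by $$\bar h_1M_1+\dots+\bar h_nM_n=\check P^2 .$$ Assume that the quadratic form $\bar h_1$ is non-degenerate, write $\bar h_1=\tfrac12\bar g(p,p)$ with $\bar g$ a contravariant metric, and let $K_1=\mathrm{Id},K_2,\dots,K_n$ be the $(1,1)$-tensors ($\bar g$-self-adjoint, Killing) determined by $\bar h_\alpha=\tfrac12\bar g(K_\alpha^*p,p)$. Then: 1. $K_i=R_iR_1^{-1}$, $i=1,\dots,n$. In particular, these Killing tensors depend only on the choice of a basis in $\mathrm{Sym}\,L$, but not on the conservation law $\mathrm d f$ used in the definition of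 $\check P$. 2. The $K_i$ are symmetries of one another, and their Haantjes torsions vanish. 3. For any $M\in\mathrm{Sym}\,L$, consider its expansion $M=g_1M_1+\dots+g_nM_n$ with respect to the basis $M_1,\dots,M_n$. Then $K_i^*\mathrm d g_1=\mathrm d g_i$. In particular, $\mathrm d g_1$ is a common conservation law of the $K_i$'s. Moreover, locally every common conservation law of the $K_i$'s can be obtained in this way for an appropriately chosen symmetry $M\in\mathrm{Sym}\,L$. 4. For any conservation law $\mathrm d r$ of $L$, consider functions $r_k$ with $\mathrm d r_k=M_k^*\mathrm d r$, $k=1,\dots,n$. Then the operator field $K=r_1K_1+\dots+r_nK_n$ is a common symmetry of the $K_i$'s. Moreover, locally every common symmetry of the $K_i$'s can be obtained in this way for an appropriately chosen conservation law $\mathrm d r$ of $L$ (and functions $r_k$).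
   Context: All constructions are local and smooth. An operator field is a $(1,1)$-tensor field. The Nijenhuis torsion of $L$ is $\mathcal N_L(\xi,\eta)=L^2[\xi,\eta]+[L\xi,L\eta]-L[L\xi,\eta]-L[\xi,L\eta]$; $L$ is Nijenhuis if $\mathcal N_L=0$. The Haantjes torsion of $K$ is $\mathcal H_K(\xi,\eta)=K^2\mathcal N_K(\xi,\eta)+\mathcal N_K(K\xi,K\eta)-K\mathcal N_K(K\xi,\eta)-K\mathcal N_K(\xi,K\eta)$. $L$ is $\mathrm{gl}$-regular if $\mathrm{Id},L,\dots,L^{n-1}$ are linearly independent at each point (equivalently, they span the centraliser of $L$). For commuting $A,B$ put $\langle A,B\rangle(\xi,\eta)=AB[\xi,\eta]+[A\xi,B\eta]-A[\xi,B\eta]-B[A\xi,\eta]$. $A$ and $B$ are symmetries of each other if $AB=BA$ and $\langle A,B\rangle(\xi,\xi)=0$ for all $\xi$; strong symmetries if $AB=BA$ and $\langle A,B\rangle=0$. $\mathrm{Sym}\,L$ is the algebra of strong symmetries of $L$; a basis of it means $n$ strong symmetries linearly independent at each point. (For $\mathrm{gl}$-regular Nijenhuis $L$ every symmetry is strong.) A conservation law of an operator field $A$ is a closed form $\mathrm d r$ with $\mathrm d(A^*\mathrm d r)=0$, where $(A^*\alpha)(\xi)=\alpha(A\xi)$; every conservation law of a $\mathrm{gl}$-regular Nijenhuis $L$ is also a conservation law of each $M\in\mathrm{Sym}\,L$. A common conservation law (common symmetry) of $K_1,\dots,K_n$ is a conservation law (symmetry) of each $K_i$. A conservation law $\mathrm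 d f$ of $L$ is regular if $\mathrm d f,L^*\mathrm d f,\dots,(L^* )^{n-1}\mathrm d f$ are linearly independent at each point. Given such $\mathrm d f$, take local coordinates with $\mathrm d u^k=(L^* )^{k-1}\mathrm d f$, $k=1,\dots,n$, with canonical momenta $p_1,\dots,p_n$ on $T^*\mathsf M$, and set $\check P=p_1\mathrm{Id}+p_2L+\dots+p_nL^{n-1}$ (at each $(p,u)$ an endomorphism of $T_u\mathsf M$). The functions $\bar h_\alpha$ are then quadratic forms in momenta and Poisson commute. *)

(* Defs.v *)
From HB Require Import structures.
From mathcomp Require Import all_boot all_order all_algebra.
From mathcomp Require Import all_classical all_reals all_analysis.

Set Implicit Arguments.
Unset Strict Implicit.
Unset Printing Implicit Defensive.

Import Order.TTheory GRing.Theory Num.Theory.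
Import numFieldNormedType.Exports.

Local Open Scope classical_set_scope.
Local Open Scope ring_scope.

(* Everything is local: the manifold is an open set U of R^(n+1), points are
   row vectors, and a tensor field is the matrix-valued function of its
   components in the standard coordinates, of which only the values on U matter.
   Vectors are columns and covectors are rows, so that an operator A acts on a
   vector X by A *m X and its dual A^* acts on a covector a by a *m A.
   The dimension is n.+1 and families are indexed from 0, so that M 0, ..., M n
   is the basis usually written M_1, ..., M_(n+1), and likewise for h, K, R. *)
Notation point R n := 'rV[R]_n.+1 (only parsing).
Notation vector_field R n := ('rV[R]_n.+1 -> 'cV[R]_n.+1) (only parsing).
Notation one_form R n := ('rV[R]_n.+1 -> 'rV[R]_n.+1) (only parsing).
Notation operator_field R n := ('rV[R]_n.+1 -> 'M[R]_n.+1) (only parsing).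

Section LocalCalculus.
Context {R : realType} {n : nat}.
Implicit Types (U : set (point R n)) (x : point R n) (f : point R n -> R)
  (X Y : vector_field R n) (alpha : one_form R n) (A B L : operator_field R n).

Definition partial (j : 'I_n.+1) f : point R n -> R :=
  fun x => 'D_(delta_mx 0 j) f x.

Fixpoint Ck (k : nat) U f : Prop :=
  (forall x, U x -> {for x, continuous f}) /\
  match k with
  | 0 => True
  | k'.+1 => forall j : 'I_n.+1,
      (forall x, U x -> derivable f x (delta_mx 0 j)) /\ Ck k' U (partial j f)
  end.

Definition smooth U f : Prop := forall k, Ck k U f.

Definition smooth_mx (p q : nat) U (T : point R n -> 'M[R]_(p, q)) : Prop :=
  forall i j, smooth U (fun x => T x i j).

Definition differential f : one_form R n := fun x => \row_j partial j f x.

Definition closed_form U alpha : Prop :=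
  smooth_mx U alpha /\
  forall x, U x -> forall i j : 'I_n.+1,
    partial i (fun y => alpha y 0 j) x = partial j (fun y => alpha y 0 i) x.

Definition op_app A X : vector_field R n := fun x => A x *m X x.

Definition dual_app A alpha : one_form R n := fun x => alpha x *m A x.

Definition lie_bracket X Y : vector_field R n := fun x =>
  \col_i \sum_j (X x j 0 * partial j (fun y => Y y i 0) x
                 - Y x j 0 * partial j (fun y => X y i 0) x).

Definition nijenhuis_torsion L X Y : vector_field R n := fun x =>
  L x ^+ 2 *m lie_bracket X Y x + lie_bracket (op_app L X) (op_app L Y) x
  - L x *m lie_bracket (op_app L X) Y x - L x *m lie_bracket X (op_app L Y) x.

Definition haantjes_torsion L X Y : vector_field R n := fun x =>
  L x ^+ 2 *m nijenhuis_torsion L X Y x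
  + nijenhuis_torsion L (op_app L X) (op_app L Y) x
  - L x *m nijenhuis_torsion L (op_app L X) Y x
  - L x *m nijenhuis_torsion L X (op_app L Y) x.

Definition nijenhuis U L : Prop :=
  smooth_mx U L /\
  forall X Y, smooth_mx U X -> smooth_mx U Y ->
    forall x, U x -> nijenhuis_torsion L X Y x = 0.

Definition haantjes U L : Prop :=
  smooth_mx U L /\
  forall X Y, smooth_mx U X -> smooth_mx U Y ->
    forall x, U x -> haantjes_torsion L X Y x = 0.

Definition pointwise_free (V : vectType R) U (T : 'I_n.+1 -> point R n -> V)
    : Prop :=
  forall x, U x -> free [seq T i x | i <- enum 'I_n.+1].

Definition gl_regular U L : Prop :=
  pointwise_free U (fun (k : 'I_n.+1) x => L x ^+ k).

Definition pair_bracket A B X Y : vector_field R n := fun x =>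
  A x *m B x *m lie_bracket X Y x + lie_bracket (op_app A X) (op_app B Y) x
  - A x *m lie_bracket X (op_app B Y) x - B x *m lie_bracket (op_app A X) Y x.

Definition commuting U A B : Prop :=
  forall x, U x -> A x *m B x = B x *m A x.

Definition symmetries U A B : Prop :=
  [/\ smooth_mx U A, smooth_mx U B, commuting U A B &
      forall X, smooth_mx U X -> forall x, U x -> pair_bracket A B X X x = 0].

Definition strong_symmetries U A B : Prop :=
  [/\ smooth_mx U A, smooth_mx U B, commuting U A B &
      forall X Y, smooth_mx U X -> smooth_mx U Y ->
        forall x, U x -> pair_bracket A B X Y x = 0].

Definition Sym U L : set (operator_field R n) :=
  [set M | strong_symmetries U L M].

Definition Sym_basis U L (M : 'I_n.+1 -> operator_field R n) : Prop :=
  (forall i, Sym U L (M i)) /\ pointwise_free U M.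

Definition conservation_law U A alpha : Prop :=
  closed_form U alpha /\ closed_form U (dual_app A alpha).

(* The k-th iterate of the dual of L on alpha = df: the differential du^(k+1) of
   the (k+1)-st coordinate attached to the conservation law df. *)
Definition du_coframe L alpha (k : 'I_n.+1) : one_form R n :=
  iter k (dual_app L) alpha.

Definition regular_conservation_law U L alpha : Prop :=
  conservation_law U L alpha /\ pointwise_free U (du_coframe L alpha).

(* The canonical momenta of the covector xi at x in the coordinates u are the
   coefficients of xi in the basis du^1, ..., du^n of the cotangent space. *)
Definition canonical_momenta L alpha x (xi p : 'rV[R]_n.+1) : Prop :=
  xi = \sum_(k < n.+1) p 0 k *: du_coframe L alpha k x.

Definition P_check L x (p : 'rV[R]_n.+1) : 'M[R]_n.+1 :=
  \sum_(k < n.+1) p 0 k *: L x ^+ k.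

Definition pairing (g : operator_field R n) x (xi eta : 'rV[R]_n.+1) : R :=
  (xi *m g x *m eta^T) 0 0.

Definition contravariant_metric U (g : operator_field R n) : Prop :=
  smooth_mx U g /\
  forall x, U x -> (g x)^T = g x /\ g x \in unitmx.

(* h i x xi is the value of \bar h_(i+1) at the covector xi over x. *)
Definition h_functions U L (M : 'I_n.+1 -> operator_field R n) alpha
    (h : 'I_n.+1 -> point R n -> 'rV[R]_n.+1 -> R) : Prop :=
  forall x xi p, U x -> canonical_momenta L alpha x xi p ->
    \sum_i h i x xi *: M i x = P_check L x p ^+ 2.

Definition killing_tensors U L (M : 'I_n.+1 -> operator_field R n) alpha
    h g (K : 'I_n.+1 -> operator_field R n) : Prop :=
  [/\ h_functions U L M alpha h,
      contravariant_metric U g,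
      forall x xi, U x -> h ord0 x xi = 2^-1 * pairing g x xi xi,
      forall i x xi eta, U x ->
        pairing g x (xi *m K i x) eta = pairing g x xi (eta *m K i x) &
      forall i x xi, U x -> h i x xi = 2^-1 * pairing g x (xi *m K i x) xi].

(* sigma k B is the sigma_k of det (t Id - B) = t^N - sigma_1 t^(N-1) - ... -
   sigma_N, where N = n.+1; it is used for 1 <= k <= N only. *)
Definition sigma (k : nat) (B : 'M[R]_n.+1) : R := - (char_poly B)`_(n.+1 - k).

(* A_op L k is A_(k+1): A_1 = Id and A_(k+1) = L A_k - sigma_k Id. *)
Fixpoint A_op L (k : nat) : operator_field R n := fun x =>
  match k with
  | 0 => 1%:M
  | k'.+1 => L x *m A_op L k' x - (sigma k'.+1 (L x))%:M
  end.

Definition R_op L (C : operator_field R n) (j : 'I_n.+1) : operator_field R n :=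
  fun x => \sum_(i < n.+1) invmx (C x) i j *: A_op L i x.

End LocalCalculus.

(* Main.v *)
(* Fix x and let e = df(x).  Since e, eL, ..., eL^n is a basis, the algebra of
   operators commuting with L(x) is R[L(x)], it acts simply transitively on
   covectors (through e), and "coefficient of L^n" is a linear functional lam
   on it for which (Q, Q') |-> lam (Q Q') is non-degenerate.  For this form
   (A_i) is dual to the powers (L^(n-i)) and (R_i) is dual to the basis (M_i).
   Hence h_i (e P) = lam (P^2 R_i), so that the metric is 2 lam (P P' R_1) and
   K_i = R_i / R_1: this is part 1.

   For commuting A and B the bracket <A, B> is a tensor, which is bilinear over
   the functions up to terms in the differentials of the coefficients.  Thus
   N = sum c_i M_i is a symmetry of L iff the R[L]-valued form
   sum (dc_i) M_i commutes with L, and by duality this means dc_i = theta R_i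
   for a single form theta.  Applied to the M_i, to the coefficients of the
   characteristic polynomial and to N this gives part 3 (with the Poincare
   lemma for the converse) and
     <L, K_i> (X, Y) = (gamma (K_i X) - K_i gamma (X)) Y
   with one R[L]-valued form gamma for all i, which forces
   <K_i, K_j> (X, X) = 0.  The Haantjes torsion vanishes for every field of
   operators with values in R[L].  Finally, for S = sum r_k K_k,
   <K_i, S> (X, X) = 0 for all i iff sum (dr_k) R_k commutes with L, i.e. iff
   dr_k = theta M_k, and theta and theta L are then closed because
   sum_k R_k (x) M_k is a symmetric tensor. *)
Require Import Defs.
From mathcomp Require Import all_boot all_order all_algebra.
From mathcomp Require Import all_classical all_reals all_analysis.
From mathcomp Require Import zify ring lra.
Import Order.TTheory GRing.Theory Num.Theory.
Import numFieldNormedType.Exports.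
Local Open Scope classical_set_scope.
Local Open Scope ring_scope.

Set Implicit Arguments.
Unset Strict Implicit.
Unset Printing Implicit Defensive.

(** * Smooth functions on an open set *)

(** Linear maps [psi] from vectors to R[L] form a module over R[L] (x) R[L], one factor acting on
    the argument and the other on the value. In it [defect B] is multiplication by B (x) 1 - 1 (x)
    B, and equivariance under B is its vanishing. For B in R[L] this element is a multiple of L (x)
    1 - 1 (x) L, the quotient being a divided difference; this is why the brackets with L alone
    control those among the K_i. When K_i and K_j are expanded in powers of L, whose mutual brackets
    vanish, <K_i, K_j> (X, X) becomes a difference of two defects applied to X. The form gamma
    starts as minus the differential of the trace times the identity, which serves all A_i.
    Non-constant coefficients in the passage to the R_i correct it on the argument side only, so a
    single form no longer gives a defect there; dividing by R_1 cancels the remaining asymmetry. In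
    the converse of part 4 the brackets are known on the diagonal only. That suffices because the
    defects have values in R[L], and an element of R[L] that kills a cyclic vector is zero. *)

Section SmoothFunctions.
Context {R : realType} {n : nat}.
Variable U : set 'rV[R]_n.+1.
Hypothesis U_open : open U.
Implicit Types (x : 'rV[R]_n.+1) (f g : 'rV[R]_n.+1 -> R) (j : 'I_n.+1).

Definition derivable_at f x := forall j, derivable f x (delta_mx 0 j).

Lemma near_open x (P : 'rV[R]_n.+1 -> Prop) :
  U x -> (forall y, U y -> P y) -> \forall y \near x, P y.
Proof.
move=> Ux UP; near=> y; apply: UP; near: y; exact: open_nbhs_nbhs.
Unshelve. all: by end_near. Qed.

Lemma partial_congr f g j x :
  U x -> (forall y, U y -> f y = g y) -> partial j f x = partial j g x.
Proof. by move=> Ux fg; apply: near_eq_derive; exact: near_open. Qed.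

Lemma partialD f g j x : derivable_at f x -> derivable_at g x ->
  partial j (fun y => f y + g y) x = partial j f x + partial j g x.
Proof. by move=> df dg; exact: deriveD (df j) (dg j). Qed.

Lemma partialN f j x : derivable_at f x ->
  partial j (fun y => - f y) x = - partial j f x.
Proof. by move=> df; exact: deriveN (df j). Qed.

Lemma partialM f g j x : derivable_at f x -> derivable_at g x ->
  partial j (fun y => f y * g y) x = f x * partial j g x + partial j f x * g x.
Proof.
move=> df dg; apply: etrans (deriveM (df j) (dg j)) _.
by congr (_ + _); exact: mulrC.
Qed.

Lemma partial_cst a j x : partial j (fun=> a) x = 0.
Proof. by rewrite /partial derive_cst. Qed.

Lemma partialV f j x : f x != 0 -> derivable_at f x ->
  partial j (fun y => (f y)^-1) x = - (f x)^-1 ^+ 2 * partial j f x.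
Proof. by move=> f0 df; rewrite exprVn; exact: deriveV f0 (df j). Qed.

Lemma derivableD_at f g x : derivable_at f x -> derivable_at g x ->
  derivable_at (fun y => f y + g y) x.
Proof. by move=> df dg j; apply: derivableD. Qed.

Lemma derivableM_at f g x : derivable_at f x -> derivable_at g x ->
  derivable_at (fun y => f y * g y) x.
Proof. by move=> df dg j; apply: derivableM. Qed.

Lemma derivable_cst_at a x : derivable_at (fun=> a) x.
Proof. by move=> j; apply: derivable_cst. Qed.

Lemma derivable_sum_at (I : Type) (r : seq I) (F : I -> 'rV[R]_n.+1 -> R) x :
  (forall i, derivable_at (F i) x) ->
  derivable_at (fun y => \sum_(i <- r) F i y) x.
Proof.
move=> dF; elim: r => [|i r IH].
  rewrite (_ : (fun y => _) = fun=> 0); first exact: derivable_cst_at.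
  by apply/funext => y; rewrite big_nil.
rewrite (_ : (fun y => _) = fun y => F i y + \sum_(i <- r) F i y).
  by apply: derivableD_at; [exact: dF|].
by apply/funext => y; rewrite big_cons.
Qed.

Lemma partial_sum (I : Type) (r : seq I) (F : I -> 'rV[R]_n.+1 -> R) j x :
  (forall i, derivable_at (F i) x) ->
  partial j (fun y => \sum_(i <- r) F i y) x = \sum_(i <- r) partial j (F i) x.
Proof.
move=> dF; elim: r => [|i r IH].
  by under eq_fun do rewrite big_nil; rewrite big_nil partial_cst.
under eq_fun do rewrite big_cons.
by rewrite big_cons partialD ?IH //; exact: derivable_sum_at.
Qed.

(** Tensor fields matter on [U] only, so regularity must not depend on values off [U]. Openness
    makes limits and partial derivatives at points of [U] insensitive to such changes. *)
Lemma Ck_congr k f g :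
  (forall x, U x -> f x = g x) -> Ck k U f -> Ck k U g.
Proof.
have cont f' g' : (forall x, U x -> f' x = g' x) ->
    (forall x, U x -> {for x, continuous f'}) ->
    forall x, U x -> {for x, continuous g'}.
  move=> fg cf x Ux; rewrite /prop_for /continuous_at -(fg x Ux).
  apply: cvg_trans (cf x Ux); apply: (@near_eq_cvg _ _ (nbhs x)).
  exact: near_open.
elim: k f g => [|k IH] f g fg [cf df]; split; try exact: cont fg cf.
  by [].
move=> j; have [df1 df2] := df j; split.
  by move=> x Ux; apply: near_eq_derivable (df1 x Ux); exact: near_open.
by apply: IH df2 => x Ux; exact: partial_congr.
Qed.

Lemma smooth_congr f g :
  (forall x, U x -> f x = g x) -> smooth U f -> smooth U g.
Proof. by move=> fg sf k; apply: Ck_congr fg (sf k). Qed.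

Lemma Ck_pred k f : Ck k.+1 U f -> Ck k U f.
Proof.
elim: k f => [|k IH] f /= [cf df]; first by split.
by split=> // j; have [? /IH] := df j.
Qed.

Lemma Ck_continuous k f x : Ck k U f -> U x -> {for x, continuous f}.
Proof. by case: k => [|k] /= [cf _] /cf. Qed.

Lemma Ck_derivable k f x : Ck k.+1 U f -> U x -> derivable_at f x.
Proof. by move=> /= [_ df] Ux j; have [+ _] := df j; exact. Qed.

Lemma smooth_continuous f x : smooth U f -> U x -> {for x, continuous f}.
Proof. by move=> sf; apply: Ck_continuous (sf 0). Qed.

Lemma smooth_derivable f x : smooth U f -> U x -> derivable_at f x.
Proof. by move=> sf; apply: Ck_derivable (sf 1). Qed.

Lemma smooth_partial f j : smooth U f -> smooth U (partial j f).
Proof. by move=> sf k; have /= [_ /(_ j)[]] := sf k.+1. Qed.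

Lemma smoothP f :
  (forall x, U x -> {for x, continuous f}) ->
  (forall x, U x -> derivable_at f x) ->
  (forall j, smooth U (partial j f)) -> smooth U f.
Proof.
move=> cf df sf [|k] /=; split=> // j; split; last exact: sf.
by move=> x Ux; apply: df.
Qed.

Lemma Ck_cst k a : Ck k U (fun=> a).
Proof.
elim: k a => [|k IH] a; split=> [x _|]; try exact: cst_continuous.
  by [].
move=> j; split=> [x _|]; first exact: derivable_cst.
by rewrite (_ : partial j _ = fun=> 0) //; apply/funext => x; rewrite partial_cst.
Qed.

Lemma CkD k f g : Ck k U f -> Ck k U g -> Ck k U (fun x => f x + g x).
Proof.
have contD f' g' m x : Ck m U f' -> Ck m U g' -> U x ->
    {for x, continuous (fun y => f' y + g' y)}.
  by move=> Cf Cg Ux; apply: continuousD; [apply: Ck_continuous Cf _|apply: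
    Ck_continuous Cg _].
elim: k f g => [|k IH] f g Cf Cg; split=> [x Ux|]; try exact: contD Cf Cg Ux.
  by [].
move=> j; split=> [x Ux|].
  by apply: derivableD; [apply: Ck_derivable Cf _ _|apply: Ck_derivable Cg _ _].
apply: Ck_congr (IH _ _ (Cf.2 j).2 (Cg.2 j).2) => x Ux.
by rewrite partialD //; [apply: Ck_derivable Cf _|apply: Ck_derivable Cg _].
Qed.

Lemma CkM k f g : Ck k U f -> Ck k U g -> Ck k U (fun x => f x * g x).
Proof.
have contM f' g' m x : Ck m U f' -> Ck m U g' -> U x ->
    {for x, continuous (fun y => f' y * g' y)}.
  by move=> Cf Cg Ux; apply: continuousM; [apply: Ck_continuous Cf _|apply:
    Ck_continuous Cg _].
elim: k f g => [|k IH] f g Cf Cg; split=> [x Ux|]; try exact: contM Cf Cg Ux.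
  by [].
move=> j; split=> [x Ux|].
  by apply: derivableM; [apply: Ck_derivable Cf _ _|apply: Ck_derivable Cg _ _].
apply: Ck_congr (CkD (IH _ _ (Ck_pred Cf) (Cg.2 j).2)
                     (IH _ _ (Cf.2 j).2 (Ck_pred Cg))) => x Ux.
by rewrite partialM //; [apply: Ck_derivable Cf _|apply: Ck_derivable Cg _].
Qed.

Lemma CkV k f :
  (forall x, U x -> f x != 0) -> Ck k U f -> Ck k U (fun x => (f x)^-1).
Proof.
move=> f0.
have contV m x : Ck m U f -> U x -> {for x, continuous (fun y => (f y)^-1)}.
  by move=> Cf Ux; apply: continuousV; [exact: f0|apply: Ck_continuous Cf _].
elim: k => [|k IH] Cf; split=> [x Ux|]; try exact: contV Cf Ux.
  by [].
move=> j; split=> [x Ux|].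
  by apply: derivableV; [exact: f0|apply: Ck_derivable Cf _ _].
have CfV := IH (Ck_pred Cf).
apply: Ck_congr (CkM (CkM (Ck_cst k (-1)) (CkM CfV CfV)) (Cf.2 j).2) => x Ux.
by rewrite partialV ?f0 ?mulN1r //; apply: Ck_derivable Cf _.
Qed.

Lemma smooth_cst a : smooth U (fun=> a).
Proof. by move=> k; exact: Ck_cst. Qed.

Lemma smoothD f g : smooth U f -> smooth U g -> smooth U (fun x => f x + g x).
Proof. by move=> sf sg k; apply: CkD. Qed.

Lemma smoothM f g : smooth U f -> smooth U g -> smooth U (fun x => f x * g x).
Proof. by move=> sf sg k; apply: CkM. Qed.

Lemma smoothN f : smooth U f -> smooth U (fun x => - f x).
Proof.
move=> sf; apply: smooth_congr (smoothM (smooth_cst (-1)) sf) => x _.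
by rewrite mulN1r.
Qed.

Lemma smoothV f :
  (forall x, U x -> f x != 0) -> smooth U f -> smooth U (fun x => (f x)^-1).
Proof. by move=> f0 sf k; apply: CkV. Qed.

Lemma smooth_sum (I : Type) (r : seq I) (F : I -> 'rV[R]_n.+1 -> R) :
  (forall i, smooth U (F i)) -> smooth U (fun x => \sum_(i <- r) F i x).
Proof.
move=> sF; elim: r => [|i r IH].
  by under eq_fun do rewrite big_nil; exact: smooth_cst.
by under eq_fun do rewrite big_cons; exact: smoothD.
Qed.

Lemma smooth_prod (I : Type) (r : seq I) (F : I -> 'rV[R]_n.+1 -> R) :
  (forall i, smooth U (F i)) -> smooth U (fun x => \prod_(i <- r) F i x).
Proof.
move=> sF; elim: r => [|i r IH].
  by under eq_fun do rewrite big_nil; exact: smooth_cst.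
by under eq_fun do rewrite big_cons; exact: smoothM.
Qed.

Lemma smooth_mx_congr p q (A B : 'rV[R]_n.+1 -> 'M[R]_(p, q)) :
  (forall x, U x -> A x = B x) -> smooth_mx U A -> smooth_mx U B.
Proof. by move=> AB sA i j; apply: smooth_congr (sA i j) => x /AB ->. Qed.

Lemma smooth_mx_cst p q (A : 'M[R]_(p, q)) : smooth_mx U (fun=> A).
Proof. by move=> i j; exact: smooth_cst. Qed.

Lemma smooth_mxD p q (A B : 'rV[R]_n.+1 -> 'M[R]_(p, q)) :
  smooth_mx U A -> smooth_mx U B -> smooth_mx U (fun x => A x + B x).
Proof.
move=> sA sB i j; apply: smooth_congr (smoothD (sA i j) (sB i j)) => x _.
by rewrite mxE.
Qed.

Lemma smooth_mxN p q (A : 'rV[R]_n.+1 -> 'M[R]_(p, q)) :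
  smooth_mx U A -> smooth_mx U (fun x => - A x).
Proof.
by move=> sA i j; apply: smooth_congr (smoothN (sA i j)) => x _; rewrite mxE.
Qed.

Lemma smooth_mxZ p q (a : 'rV[R]_n.+1 -> R) (A : 'rV[R]_n.+1 -> 'M[R]_(p, q)) :
  smooth U a -> smooth_mx U A -> smooth_mx U (fun x => a x *: A x).
Proof.
by move=> sa sA i j; apply: smooth_congr (smoothM sa (sA i j)) => x _; rewrite mxE.
Qed.

Lemma smooth_mxM p q r (A : 'rV[R]_n.+1 -> 'M[R]_(p, q))
    (B : 'rV[R]_n.+1 -> 'M[R]_(q, r)) :
  smooth_mx U A -> smooth_mx U B -> smooth_mx U (fun x => A x *m B x).
Proof.
move=> sA sB i j.
apply: (@smooth_congr (fun x => \sum_k A x i k * B x k j)).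
  by move=> x _; rewrite mxE.
by apply: smooth_sum => k; apply: smoothM.
Qed.

Lemma smooth_mx_sum p q (I : Type) (r : seq I)
    (A : I -> 'rV[R]_n.+1 -> 'M[R]_(p, q)) :
  (forall i, smooth_mx U (A i)) -> smooth_mx U (fun x => \sum_(i <- r) A i x).
Proof.
move=> sA; elim: r => [|i r IH].
  by under eq_fun do rewrite big_nil; exact: smooth_mx_cst.
by under eq_fun do rewrite big_cons; exact: smooth_mxD.
Qed.

Lemma smooth_mxX (A : 'rV[R]_n.+1 -> 'M[R]_n.+1) k :
  smooth_mx U A -> smooth_mx U (fun x => A x ^+ k).
Proof.
move=> sA; elim: k => [|k IH]; first exact: smooth_mx_cst.
by under eq_fun do rewrite exprS; exact: smooth_mxM.
Qed.

Lemma smooth_det m (A : 'rV[R]_n.+1 -> 'M[R]_m) :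
  smooth_mx U A -> smooth U (fun x => \det (A x)).
Proof.
move=> sA; apply: smooth_sum => s; apply: smoothM; first exact: smooth_cst.
by apply: smooth_prod => i.
Qed.

Lemma smooth_invmx m (A : 'rV[R]_n.+1 -> 'M[R]_m) :
  (forall x, U x -> A x \in unitmx) ->
  smooth_mx U A -> smooth_mx U (fun x => invmx (A x)).
Proof.
move=> uA sA; apply: (@smooth_mx_congr _ _ (fun x => (\det (A x))^-1 *: \adj (A x))).
  by move=> x Ux; rewrite /invmx uA.
apply: smooth_mxZ.
  apply: smoothV; last exact: smooth_det.
  by move=> x Ux; have := uA x Ux; rewrite unitmxE unitfE.
move=> i j; apply: (@smooth_congr (fun x => cofactor (A x) j i)).
  by move=> x _; rewrite mxE.
apply: smoothM; first exact: smooth_cst.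
apply: smooth_det => k l.
by apply: smooth_congr (sA (lift j k) (lift i l)) => x _; rewrite !mxE.
Qed.

End SmoothFunctions.

Lemma smooth_subset (R : realType) n (U V : set 'rV[R]_n.+1) f :
  V `<=` U -> smooth U f -> smooth V f.
Proof.
move=> VU sf k; have {sf} := sf k.
elim: k f => [|k IH] f /= [cf df]; split; try by move=> x /VU/cf.
  by [].
move=> j; by have [df1 df2] := df j; split; [move=> x /VU/df1|apply: IH].
Qed.

Lemma smooth_mx_subset (R : realType) n (U V : set 'rV[R]_n.+1) p q
    (A : 'rV[R]_n.+1 -> 'M[R]_(p, q)) :
  V `<=` U -> smooth_mx U A -> smooth_mx V A.
Proof. by move=> VU sA i j; apply: smooth_subset VU (sA i j). Qed.

(** * The mean value theorem in several variables *)

Section SeveralVariables.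
Context {R : realType} {n : nat}.
Implicit Types (x y v : 'rV[R]_n.+1) (f : 'rV[R]_n.+1 -> R).

Lemma norm_row_le v c : 0 <= c -> (forall j, `|v 0 j| <= c) -> `|v| <= c.
Proof.
move=> c0 vc; rewrite [leLHS]/Num.Def.normr /= mx_normrE.
by apply: bigmax_le => // -[i j] _ /=; rewrite ord1.
Qed.

Lemma entry_le_norm v j : `|v 0 j| <= `|v|.
Proof.
rewrite [leRHS]/Num.Def.normr /= mx_normrE.
exact: (le_bigmax _ (fun ij : 'I_1 * 'I_n.+1 => `|v ij.1 ij.2|) (0, j)).
Qed.

Lemma line_is_derive f y v (t : R) :
  derivable f (y + t *: v) v ->
  is_derive t 1 (fun s => f (y + s *: v)) ('D_v f (y + t *: v)).
Proof.
move=> df.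
have E : (fun h : R => h^-1 *: (((fun s => f (y + s *: v)) \o shift t) (h *: 1) - f
  (y + t *: v)))
  = (fun h => h^-1 *: ((f \o shift (y + t *: v)) (h *: v) - f (y + t *: v))).
  apply/funext => h /=; congr (_ *: (f _ - _)).
  by rewrite scalerDl [h *: 1]mulr1 addrCA.
apply: DeriveDef; first by rewrite /derivable E.
by rewrite /derive E.
Qed.

(** Increments along an axis may have either sign or vanish, hence the three cases and the weak
    bound on [c]. *)
Lemma directional_MVT f y v (h : R) :
  (forall t : R, `|t| <= `|h| -> derivable f (y + t *: v) v) ->
  exists2 c, `|c| <= `|h| & f (y + h *: v) - f y = h * 'D_v f (y + c *: v).
Proof.
move=> df; pose g s := f (y + s *: v).
have g0 : g 0 = f y by rewrite /g scale0r addr0.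
have dg (t : R) : `|t| <= `|h| -> is_derive t 1 g ('D_v f (y + t *: v)).
  by move=> /df; exact: line_is_derive.
have cg (a b : R) : (forall t, t \in `[a, b]%R -> `|t| <= `|h|) -> {within `[a, b],
  continuous g}.
  move=> ab; apply: derivable_within_continuous => t /ab /dg dgt.
  exact: ex_derive.
have [h0|h0|h0] := ltgtP h 0.
- have hh (t : R) : t \in `[h, 0]%R -> `|t| <= `|h|.
    rewrite in_itv /= => /andP[ht t0]; rewrite ler0_norm // ler0_norm ?(ltW h0) //.
    by rewrite lerN2.
  have [c ch E] := MVT h0 (fun t th => dg t (hh t (subset_itv_oo_cc th))) (cg _ _ hh).
  exists c; first exact/hh/subset_itv_oo_cc.
  by rewrite -g0 -/(g h) -[LHS]opprB E; ring.
- have hh (t : R) : t \in `[0, h]%R -> `|t| <= `|h|.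
    by rewrite in_itv /= => /andP[t0 th]; rewrite !ger0_norm // ltW.
  have [c ch E] := MVT h0 (fun t th => dg t (hh t (subset_itv_oo_cc th))) (cg _ _ hh).
  exists c; first exact/hh/subset_itv_oo_cc.
  by rewrite -g0 -/(g h) E subr0 mulrC.
- by exists 0; rewrite ?normr0 // h0 scale0r addr0 mul0r subrr.
Qed.

(** Go from [x] to [x + v] one coordinate at a time: each leg is parallel to an axis, and in the sup
    norm the whole path stays within [|v|] of [x]. *)
Lemma telescoping_MVT f x v :
  (forall y, `|y - x| <= `|v| -> derivable_at f y) ->
  exists2 xi : 'I_n.+1 -> 'rV[R]_n.+1, forall j, `|xi j - x| <= `|v| &
    f (x + v) - f x = \sum_j v 0 j * partial j f (xi j).
Proof.
move=> df.
pose w (k : nat) : 'rV[R]_n.+1 := \row_j (if (j < k)%N then v 0 j else 0).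
have wS (j : 'I_n.+1) : w j.+1 = w j + v 0 j *: delta_mx 0 j.
  apply/rowP => i; rewrite !mxE eqxx /= ltnS leq_eqVlt.
  have [->|ij] := eqVneq i j; first by rewrite eqxx ltnn /= mulr1 add0r.
  by rewrite -val_eqE in ij; rewrite (negbTE ij) mulr0 addr0.
have wle (j : 'I_n.+1) t : `|t| <= `|v 0 j| -> `|w j + t *: delta_mx 0 j| <= `|v|.
  move=> tv; apply: norm_row_le => // i; rewrite !mxE eqxx /=.
  have [->|ij] := eqVneq i j.
    by rewrite ltnn add0r mulr1 (le_trans tv) // entry_le_norm.
  by rewrite mulr0 addr0; case: ifP => _; rewrite ?normr0 // entry_le_norm.
have xK a b : x + a + b - x = a + b by apply/rowP => i; rewrite !mxE; ring.
have step (j : 'I_n.+1) : exists xi, `|xi - x| <= `|v| /\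
    f (x + w j.+1) - f (x + w j) = v 0 j * partial j f xi.
  have [|c cv E] := @directional_MVT f (x + w j) (delta_mx 0 j) (v 0 j).
    by move=> t tv; apply: df; rewrite xK wle.
  exists (x + w j + c *: delta_mx 0 j); split.
    by rewrite xK wle.
  by rewrite -E wS addrA.
have [xi xiP] := choice step.
exists xi => [j|]; first by have [] := xiP j.
transitivity (\sum_(j < n.+1) (f (x + w j.+1) - f (x + w j))).
  rewrite -(big_mkord xpredT (fun j => f (x + w j.+1) - f (x + w j))) telescope_sumr //.
  congr (f (x + _) - f _); first by apply/rowP => j; rewrite mxE ltn_ord.
  by apply/rowP => j; rewrite !mxE addr0.
by apply: eq_bigr => j _; have [_ ->] := xiP j.
Qed.

Lemma near_norm_ball x (P : 'rV[R]_n.+1 -> Prop) :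
  (\forall y \near x, P y) -> exists2 r : R, 0 < r & forall y, `|y - x| < r -> P y.
Proof.
move=> /nbhs_ballP[r /= r0 xrP]; exists r => // y yx; apply: xrP.
by rewrite -ball_normE /= distrC.
Qed.

(** Telescoping expresses the increment by partial derivatives at points near [x], and their
    continuity moves them to [x]. *)
Lemma C1_directional f x v :
  (\forall y \near x, derivable_at f y) ->
  (forall j, {for x, continuous (partial j f)}) ->
  is_derive x v f (\sum_j v 0 j * partial j f x).
Proof.
move=> df cf; set l := \sum_j _.
suff cvl : h^-1 *: ((f \o shift x) (h *: v) - f x) @[h --> 0^'] --> l.
  apply: DeriveDef; first by apply/cvg_ex; exists l.
  by apply/cvg_lim.
apply/cvgrPdist_le => e e0 /=.
(* The summand 1 keeps [S] positive when [v = 0], so that [e / S] is a legitimate tolerance. *)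
pose S := \sum_j `|v 0 j| + 1.
have S0 : 0 < S by rewrite ltr_wpDl // sumr_ge0.
have eS : 0 < e / S by rewrite divr_gt0.
have : \forall y \near x, derivable_at f y /\
    forall j, `|partial j f x - partial j f y| <= e / S.
  near=> y; split; first by near: y.
  near: y; apply: filter_forall => j.
  by have /cvgrPdist_le/(_ _ eS) := cf j.
move=> /near_norm_ball[r r0 xr].
have v1 : 0 < `|v| + 1 by rewrite ltr_wpDl.
near=> h.
have h0 : h != 0 by near: h; exact: nbhs_dnbhs_neq.
have hv : `|h *: v| < r.
  rewrite normrZ (@le_lt_trans _ _ (`|h| * (`|v| + 1))) ?ler_wpM2l ?lerDl //.
  rewrite -ltr_pdivlMr //; near: h; apply: dnbhs0_lt; exact: divr_gt0.
have [y yx|xi xix E] := @telescoping_MVT f x (h *: v).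
  by have [] := xr y (le_lt_trans yx hv).
rewrite /= [h *: v + x]addrC E scaler_sumr -sumrB.
apply: (@le_trans _ _ (\sum_j `|v 0 j| * (e / S))).
  apply: (le_trans (ler_norm_sum _ _ _)); apply: ler_sum => j _.
  rewrite mxE [_ *: _]mulrA mulrA mulVf // mul1r -mulrBr normrM ler_wpM2l //.
  by have [_] := xr (xi j) (le_lt_trans (xix j) hv).
rewrite -mulr_suml mulrA ler_pdivrMr // mulrC ler_wpM2l ?(ltW e0) //.
by rewrite /S lerDl.
Unshelve. all: by end_near. Qed.

(** Near [x] the partial derivatives are within 1 of their values at [x], hence bounded, and
    telescoping bounds [f y - f x] by a multiple of [|y - x|]. *)
Lemma C1_continuous f x :
  (\forall y \near x, derivable_at f y) ->
  (forall j, {for x, continuous (partial j f)}) -> {for x, continuous f}.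
Proof.
move=> df cf; apply/(@cvgrPdist_le _ _ _ (nbhs x)) => e e0 /=.
have : \forall y \near x, derivable_at f y /\
    forall j, `|partial j f x - partial j f y| <= 1.
  near=> y; split; first by near: y.
  near: y; apply: filter_forall => j.
  by have /cvgrPdist_le/(_ _ ltr01) := cf j.
move=> /near_norm_ball[r r0 xr].
pose S := \sum_j (`|partial j f x| + 1).
have S0 : 0 < S.
  by rewrite /S big_ord_recl ltr_pwDl ?sumr_ge0 // => [|i _]; rewrite ?ltr_wpDl
    ?addr_ge0.
near=> y.
have yx : `|y - x| < r by rewrite distrC; near: y; exact: cvgr_dist_lt.
have yxe : `|y - x| <= e / S.
  by rewrite distrC; near: y; apply: cvgr_dist_le => //; rewrite divr_gt0.
have [z zx|xi xix] := @telescoping_MVT f x (y - x).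
  by have [] := xr z (le_lt_trans zx yx).
rewrite addrCA subrr addr0 distrC => ->.
apply: (le_trans (ler_norm_sum _ _ _)).
apply: (@le_trans _ _ (\sum_j (e / S) * (`|partial j f x| + 1))).
  apply: ler_sum => j _; rewrite normrM ler_pM //.
    exact: le_trans (entry_le_norm _ j) yxe.
  have [_ /(_ j)] := xr (xi j) (le_lt_trans (xix j) yx).
  rewrite distrC => le1; rewrite -[partial j f (xi j)](subrK (partial j f x)).
  by rewrite (le_trans (ler_normD _ _)) // addrC lerD2l.
by rewrite -mulr_sumr divfK // gt_eqF.
Unshelve. all: by end_near. Qed.

End SeveralVariables.

(** * The Schwarz and Poincare lemmas *)

Section SchwarzPoincare.
Context {R : realType} {n : nat}.
Implicit Types (x y v : 'rV[R]_n.+1) (f : 'rV[R]_n.+1 -> R).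

(** Substituting in the difference quotient itself gives the chain rule for affine maps without
    differentiability assumptions and for every [k], zero included. *)
Lemma affine_quotient f (k : R) a x v :
  (fun h : R => h^-1 *: (((fun y => f (k *: y + a)) \o shift x) (h *: v) - f (k *: x
    + a)))
  = (fun h => h^-1 *: ((f \o shift (k *: x + a)) (h *: (k *: v)) - f (k *: x + a))).
Proof.
apply/funext => h /=; congr (_ *: (f _ - _)).
by rewrite scalerDr !scalerA mulrC addrA.
Qed.

Lemma derive_affine f (k : R) a x v :
  'D_v (fun y => f (k *: y + a)) x = 'D_(k *: v) f (k *: x + a).
Proof. by rewrite /derive affine_quotient. Qed.

Lemma derivable_affine f (k : R) a x v :
  derivable f (k *: x + a) (k *: v) -> derivable (fun y => f (k *: y + a)) x v.
Proof. by rewrite /derivable affine_quotient. Qed.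

Lemma norm_delta_le (t : R) j : `|t *: delta_mx 0 j : 'rV[R]_n.+1| <= `|t|.
Proof.
apply: norm_row_le => // i; rewrite !mxE eqxx /=.
by case: eqP => _; rewrite ?mulr1 // mulr0 normr0.
Qed.

Lemma near_dist_le f x (e : R) :
  {for x, continuous f} -> 0 < e -> \forall y \near x, `|f x - f y| <= e.
Proof. by move=> /(@cvgrPdist_le _ _ _ (nbhs x)) + e0 => /(_ e e0). Qed.

Lemma dist_le_split (a b c e : R) :
  `|a - c| <= e / 2 -> `|b - c| <= e / 2 -> `|a - b| <= e.
Proof.
rewrite !ler_norml => /andP[ac1 ac2] /andP[bc1 bc2].
by apply/andP; split; lra.
Qed.

(** The second difference is the increment along axis [i] of [f (y + a) - f y]. One mean value
    theorem along [i] and a second one along [j] turn it into a mixed derivative. *)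
Lemma second_difference f i j x (h : R) :
  (forall y, `|y - x| <= `|h| + `|h| -> derivable_at f y /\ derivable_at (partial i
    f) y) ->
  exists2 z, `|z - x| <= `|h| + `|h| &
    f (x + h *: delta_mx 0 i + h *: delta_mx 0 j) - f (x + h *: delta_mx 0 i)
    - (f (x + h *: delta_mx 0 j) - f x) = h * (h * partial j (partial i f) z).
Proof.
move=> df; set a := h *: delta_mx 0 j.
(* The factor 1 puts the translate in the shape of [derive_affine]. *)
pose g y := f (1 *: y + a) - f y.
have gE y : f (y + a) - f y = g y by rewrite /g scale1r.
have sm (c d : R) : `|c| <= `|h| -> `|d| <= `|h| ->
    `|x + c *: delta_mx 0 i + d *: delta_mx 0 j - x| <= `|h| + `|h|.
  move=> ch dh.
  rewrite (_ : _ - x = c *: delta_mx 0 i + d *: delta_mx 0 j).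
    by rewrite (le_trans (ler_normD _ _)) // lerD // (le_trans (norm_delta_le _ _)).
  by apply/rowP => k; rewrite !mxE; ring.
have sm0 (c : R) : `|c| <= `|h| -> `|x + c *: delta_mx 0 i - x| <= `|h| + `|h|.
  by move=> ch; have := sm c 0 ch; rewrite scale0r addr0 normr0; exact.
have dga (c : R) : `|c| <= `|h| ->
    derivable (fun y => f (1 *: y + a)) (x + c *: delta_mx 0 i) (delta_mx 0 i).
  move=> ch; apply: derivable_affine; rewrite !scale1r.
  by have [+ _] := df _ (sm c h ch (lexx _)); apply.
rewrite !gE.
have [|c ch ->] := @directional_MVT _ _ g x (delta_mx 0 i) h.
  move=> t th; apply: derivableB; first exact: dga.
  by have [+ _] := df _ (sm0 t th); apply.
have -> : 'D_(delta_mx 0 i) g (x + c *: delta_mx 0 i)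
    = partial i f (x + c *: delta_mx 0 i + a) - partial i f (x + c *: delta_mx 0 i).
  rewrite /g deriveB; first by rewrite derive_affine !scale1r.
    exact: dga.
  by have [+ _] := df _ (sm0 c ch); apply.
have [|d dh ->] := @directional_MVT _ _ (partial i f) (x + c *: delta_mx 0 i)
  (delta_mx 0 j) h.
  by move=> t th; have [_] := df _ (sm c t ch th); apply.
by exists (x + c *: delta_mx 0 i + d *: delta_mx 0 j); first exact: sm.
Qed.

(** The second difference is symmetric in [i] and [j], so the two mixed derivatives agree at some
    points [z] and [w] arbitrarily close to [x]; continuity does the rest. *)
Lemma Schwarz (U : set 'rV[R]_n.+1) f i j x :
  open U -> Ck 2 U f -> U x ->
  partial i (partial j f) x = partial j (partial i f) x.
Proof.
move=> Uo Cf Ux.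
have C1 k : Ck 1 U (partial k f) by have [_ /(_ k)[]] := Cf.
have C0 k l : {for x, continuous (partial k (partial l f))}.
  have C : Ck 0 U (partial k (partial l f)) by have [_ /(_ k)[]] := C1 l.
  exact: Ck_continuous C Ux.
apply/eqP; rewrite -subr_eq0 -normr_le0; apply/ler_addgt0Pr => e e0; rewrite add0r.
have e2 : 0 < e / 2 by rewrite divr_gt0.
have : \forall y \near x, [/\ U y,
    `|partial i (partial j f) x - partial i (partial j f) y| <= e / 2 &
    `|partial j (partial i f) x - partial j (partial i f) y| <= e / 2].
  apply: filterS3 (near_open Uo Ux (fun y Uy => Uy))
    (near_dist_le (C0 i j) e2) (near_dist_le (C0 j i) e2).
  by move=> y ? ? ?; split.
move=> /near_norm_ball[r r0 xr].
(* The points [z] and [w] lie within [2 h] of [x], which must be less than [r]. *)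
pose h := r / 3; have h0 : 0 < h by rewrite divr_gt0.
have hr : `|h| + `|h| < r by rewrite gtr0_norm // /h; lra.
have [y yx|z zx Ez] := @second_difference f i j x h.
  have [Uy _ _] := xr y (le_lt_trans yx hr).
  by split; [exact: Ck_derivable Cf Uy|exact: Ck_derivable (C1 i) Uy].
have [y yx|w wx Ew] := @second_difference f j i x h.
  have [Uy _ _] := xr y (le_lt_trans yx hr).
  by split; [exact: Ck_derivable Cf Uy|exact: Ck_derivable (C1 j) Uy].
have [_ _ bz] := xr z (le_lt_trans zx hr).
have [_ bw _] := xr w (le_lt_trans wx hr).
have zw : partial j (partial i f) z = partial i (partial j f) w.
  apply: (mulfI (lt0r_neq0 h0)); apply: (mulfI (lt0r_neq0 h0)).
  apply: etrans (esym Ez) (etrans _ Ew).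
  by rewrite [x + h *: delta_mx 0 j + _]addrAC; ring.
by apply: (dist_le_split bw); rewrite -zw; exact: bz.
Qed.

End SchwarzPoincare.

(** * The homotopy primitive of a closed form on a ball *)

Section Poincare.
Context {R : realType} {n : nat}.
Implicit Types (x y v : 'rV[R]_n.+1) (f : 'rV[R]_n.+1 -> R).
Variables (alpha : 'rV[R]_n.+1 -> 'rV[R]_n.+1) (x0 : 'rV[R]_n.+1) (r : R)
  (M : 'I_n.+1 -> R) (M' : 'I_n.+1 -> 'I_n.+1 -> R).
Local Notation B := (ball x0 r).
Hypothesis alpha_closed : closed_form B alpha.
Hypothesis alpha_bound : forall i x, B x -> `|alpha x 0 i| <= M i.
Hypothesis dalpha_bound : forall i j x, B x ->
  `|partial j (fun y => alpha y 0 i) x| <= M' i j.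

Let mu := @lebesgue_measure R.
Let al i : 'rV[R]_n.+1 -> R := fun y => alpha y 0 i.
Let dal j i : 'rV[R]_n.+1 -> R := partial j (al i).

Lemma mem_ball y : B y <-> `|y - x0| < r.
Proof. by rewrite -ball_normE /= distrC. Qed.

Let ray x (t : R) : 'rV[R]_n.+1 := x0 + t *: (x - x0).
Let Phi x (t : R) : R := \sum_i (x - x0) 0 i * al i (ray x t).
(** It plays two roles: it is the [j]-th partial derivative of [Phi] in [x], and, when [alpha] is
    closed, the derivative in [t] of [t * al j (ray x t)]. The second role evaluates its integral to
    [al j x]. *)
Let dPhi j x (t : R) : R :=
  al j (ray x t) + \sum_i (x - x0) 0 i * (t * dal j i (ray x t)).

Let B_open : open B.
Proof. exact: ball_open. Qed.

Let smooth_al i : smooth B (al i).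
Proof. by have [+ _] := alpha_closed; apply. Qed.

Let smooth_dal j i : smooth B (dal j i).
Proof. exact: smooth_partial. Qed.

Let ray_ball x t : B x -> t \in `[0, 1]%R -> B (ray x t).
Proof.
move=> /mem_ball xr; rewrite in_itv /= => /andP[t0 t1]; apply/mem_ball.
rewrite /ray addrC addKr normrZ ger0_norm // (le_lt_trans _ xr) //.
by rewrite ler_piMl.
Qed.

Let C1_is_derive f x v : smooth B f -> B x ->
  is_derive x v f (\sum_j v 0 j * partial j f x).
Proof.
move=> sf Bx; apply: C1_directional.
  by apply: near_open Bx _ => // y By; exact: smooth_derivable By.
by move=> j; apply: smooth_continuous Bx; exact: smooth_partial.
Qed.

Let ray_affine x t : ray x t = t *: x + (x0 - t *: x0).
Proof. by rewrite /ray scalerBr addrCA. Qed.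

Let ray_derivable f x t : smooth B f -> B (ray x t) ->
  derivable_at (fun y => f (ray y t)) x.
Proof.
move=> sf Bxt j; under eq_fun do rewrite ray_affine.
apply: derivable_affine; rewrite -ray_affine; apply: ex_derive.
exact: (C1_is_derive (t *: delta_mx 0 j) sf Bxt).
Qed.

Let ray_partial f j x t : smooth B f -> B (ray x t) ->
  partial j (fun y => f (ray y t)) x = t * partial j f (ray x t).
Proof.
move=> sf Bxt; rewrite /partial; under eq_fun do rewrite ray_affine.
rewrite derive_affine -ray_affine.
have /@derive_val -> := C1_is_derive (t *: delta_mx 0 j) sf Bxt.
rewrite (bigD1 j) //= big1.
  by rewrite !mxE !eqxx mulr1 addr0.
by move=> i /negbTE ij; rewrite !mxE eqxx ij mulr0 mul0r.
Qed.

Let coord_is_derive i x v : is_derive x v (fun y => (y - x0) 0 i) (v 0 i).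
Proof.
have cv : h^-1 *: (((fun y => (y - x0) 0 i) \o shift x) (h *: v) - (x - x0) 0 i)
    @[h --> 0^'] --> v 0 i.
  apply: cvg_near_cst; near=> h.
  have h0 : h != 0 by near: h; exact: nbhs_dnbhs_neq.
  rewrite /= !mxE (_ : _ - _ = h * v 0 i); last by ring.
  by rewrite [LHS]mulKf.
apply: DeriveDef; first by apply/cvg_ex; exists (v 0 i).
exact/cvg_lim.
Unshelve. all: by end_near. Qed.

Let coord_derivable i x : derivable_at (fun y => (y - x0) 0 i) x.
Proof. by move=> j; apply: ex_derive; exact: coord_is_derive. Qed.

Let coord_partial i j x : partial j (fun y => (y - x0) 0 i) x = (i == j)%:R.
Proof.
rewrite /partial; have /@derive_val -> := coord_is_derive i x (delta_mx 0 j).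
by rewrite mxE eqxx.
Qed.

Let term_derivable i x t : B (ray x t) ->
  derivable_at (fun y => (y - x0) 0 i * al i (ray y t)) x.
Proof.
move=> Bxt; exact: (@derivableM_at _ _ (fun y => (y - x0) 0 i)
  (fun y => al i (ray y t)) x (@coord_derivable i x) (@ray_derivable _ x t
    (@smooth_al i) Bxt)).
Qed.

Let Phi_derivable x t : B (ray x t) -> derivable_at (Phi ^~ t) x.
Proof. by move=> Bxt; apply: derivable_sum_at => i; exact: term_derivable. Qed.

Let Phi_partial j x t : B (ray x t) -> partial j (Phi ^~ t) x = dPhi j x t.
Proof.
move=> Bxt; rewrite /Phi partial_sum; last by move=> i; exact: term_derivable.
have E i : partial j (fun y => (y - x0) 0 i * al i (ray y t)) x
    = (x - x0) 0 i * (t * dal j i (ray x t)) + (i == j)%:R * al i (ray x t).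
  have := @partialM _ _ (fun y => (y - x0) 0 i) (fun y => al i (ray y t)) j x
    (@coord_derivable i x) (@ray_derivable _ x t (@smooth_al i) Bxt).
  by rewrite (ray_partial _ (smooth_al i) Bxt) coord_partial.
rewrite (eq_bigr _ (fun i _ => E i)) big_split /= addrC; congr (_ + _).
rewrite (bigD1 j) //= big1; first by rewrite eqxx mul1r addr0.
by move=> i /negbTE ->; rewrite mul0r.
Qed.

Let ray_line f x t : smooth B f -> B (ray x t) ->
  is_derive t 1 (fun s => f (ray x s)) (\sum_j (x - x0) 0 j * partial j f (ray x t)).
Proof.
move=> sf Bxt; have D := C1_is_derive (x - x0) sf Bxt.
have /@derive_val <- := D.
by apply: line_is_derive; have /@ex_derive := D.
Qed.

Let ray_line_derivable f x t : smooth B f -> B (ray x t) ->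
  derivable (fun s => f (ray x s)) t 1.
Proof. by move=> sf /(ray_line sf)/@ex_derive. Qed.

Let within01 (h : R -> R) : (forall t, t \in `[0, 1]%R -> derivable h t 1) ->
  {within `[0, 1], continuous h}.
Proof. by move=> dh; apply: derivable_within_continuous => t /dh. Qed.

Let sum_derivable (h : 'I_n.+1 -> R -> R) t :
  (forall i, derivable (h i) t 1) -> derivable (fun t => \sum_i h i t) t 1.
Proof.
move=> dh; rewrite (_ : (fun _ => _) = \sum_i h i); first exact: derivable_sum.
by apply/funext => s; rewrite fct_sumE.
Qed.

Let Phi_continuous x : B x -> {within `[0, 1], continuous (Phi x)}.
Proof.
move=> Bx; apply: within01 => t t01; apply: sum_derivable => i.
apply: derivableM; first exact: derivable_cst.
exact: ray_line_derivable (ray_ball Bx t01).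
Qed.

Let dPhi_continuous j x : B x -> {within `[0, 1], continuous (dPhi j x)}.
Proof.
move=> Bx; apply: within01 => t t01; apply: derivableD.
  exact: ray_line_derivable (ray_ball Bx t01).
apply: sum_derivable => i; apply: derivableM; first exact: derivable_cst.
apply: derivableM; first exact: derivable_id.
exact: ray_line_derivable (@smooth_dal j i) (ray_ball Bx t01).
Qed.

(** This is where closedness enters: it swaps the indices of [dal], so that the derivative along the
    ray becomes the sum in [dPhi]. *)
Let primitive j x t : B (ray x t) ->
  is_derive t 1 (fun s => s * al j (ray x s)) (dPhi j x t).
Proof.
move=> Bxt; have [_ cl] := alpha_closed.
have D := ray_line (smooth_al j) Bxt.
have := @is_deriveM _ _ (@id R) (fun s => al j (ray x s)) t 1 _ _ (is_derive_id t 1) D.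
congr (is_derive _ _ _ _).
rewrite /dPhi addrC; congr (_ + _); first by rewrite [LHS]mulr1.
rewrite [LHS]mulr_sumr; apply: eq_bigr => i _.
by rewrite mulrCA /dal [partial j _ _](cl _ Bxt).
Qed.

Let integral_dPhi j x : B x -> \int[mu]_(t in `[0, 1]) dPhi j x t = al j x.
Proof.
move=> Bx; have dH t (t01 : t \in `[0, 1]%R) := primitive j (ray_ball Bx t01).
have cH (t : R) : t \in `[0, 1]%R -> {for t, continuous (fun s : R => s * al j (ray x
  s))}.
  move=> /dH/@ex_derive/derivable1_diffP; exact: differentiable_continuous.
rewrite /Rintegral (@continuous_FTC2 _ _ (fun s : R => s * al j (ray x s))) //=.
- by rewrite mul0r mul1r subr0 /ray scale1r addrCA subrr addr0.
- exact: dPhi_continuous.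
- split.
  + by move=> t /subset_itv_oo_cc/dH/@ex_derive.
  + by apply: cvg_at_right_filter; apply: cH; rewrite in_itv /= lexx ler01.
  + by apply: cvg_at_left_filter; apply: cH; rewrite in_itv /= lexx ler01.
- by move=> t /subset_itv_oo_cc/dH D; rewrite derive1E; exact: derive_val.
Qed.

Let dPhi_bound j x t : B x -> t \in `[0, 1]%R ->
  `|dPhi j x t| <= M j + \sum_(i < n.+1) r * M' i j.
Proof.
move=> Bx t01; have Bxt := ray_ball Bx t01.
rewrite (le_trans (ler_normD _ _)) // lerD ?alpha_bound //.
rewrite (le_trans (ler_norm_sum _ _ _)) // ler_sum // => i _.
rewrite !normrM ler_pM //.
  by rewrite (le_trans (entry_le_norm _ _)) // ltW //; exact/mem_ball.
rewrite -[leRHS]mul1r ler_pM // ?dalpha_bound //.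
by move: t01; rewrite in_itv /= => /andP[t0 t1]; rewrite ger0_norm.
Qed.

Let potential x : R := \int[mu]_(t in `[0, 1]) Phi x t.

(** Differentiation under the integral sign, dominated by a constant. Smoothness on the open ball
    does not bound [alpha] up to the boundary, whence the two bounds assumed in this section. *)
Let potential_is_derive j x : B x -> is_derive x (delta_mx 0 j) potential (al j x).
Proof.
move=> Bx; pose d := r - `|x - x0|.
have d0 : 0 < d by rewrite subr_gt0; exact/mem_ball.
have Bs (s : R) : s \in `]- d, d[%R -> B (x + s *: delta_mx 0 j).
  rewrite in_itv /= -ltr_norml => sd; apply/mem_ball.
  rewrite addrAC (le_lt_trans (ler_normD _ _)) // -ltrBrDl.
  exact: le_lt_trans (norm_delta_le _ _) sd.
pose F (s t : R) := Phi (x + s *: delta_mx 0 j) t.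
have dF (s t : R) : s \in `]- d, d[%R -> t \in `[0, 1]%R ->
    is_derive s 1 (F ^~ t) (dPhi j (x + s *: delta_mx 0 j) t).
  move=> /Bs Bxs t01; have Bst := ray_ball Bxs t01.
  have := @line_is_derive _ _ (Phi ^~ t) x (delta_mx 0 j) s (@Phi_derivable _ t Bst j).
  by rewrite -/(partial j _ _) Phi_partial.
have cvF : h^-1 *: (\int[mu]_(t in `[0, 1]) F (h + 0) t - \int[mu]_(t in `[0, 1]) F 0 t)
    @[h --> 0^'] --> \int[mu]_(t in `[0, 1]) partial1of2 F 0 t.
  apply: (@cvg_differentiation_under_integral _ _ _ mu F `[0, 1] _ 0 (- d) d _ _ _
    (fun=> M j + \sum_(i < n.+1) r * M' i j)) => //.
  - by rewrite /= in_itv /= oppr_lt0 d0.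
  - move=> s /Bs Bxs; apply: continuous_compact_integrable.
      exact: segment_compact.
    exact: Phi_continuous.
  - by move=> s t sI t01; have /@ex_derive := dF s t sI t01.
  - have := @dPhi_bound j x 0 Bx; rewrite in_itv /= lexx ler01 => /(_ isT) + _.
    exact: le_trans (normr_ge0 _).
  - apply: continuous_compact_integrable; first exact: segment_compact.
    by move=> ?; exact: cst_continuous.
  - move=> s t sI t01; rewrite partial1of2E.
    by have /@derive_val -> := dF s t sI t01; apply: dPhi_bound (Bs s sI) t01.
have EF : \int[mu]_(t in `[0, 1]) partial1of2 F 0 t = al j x.
  rewrite -integral_dPhi //; apply: eq_Rintegral => t; rewrite inE /= => t01.
  rewrite partial1of2E; have I0 : 0 \in `]- d, d[%R by rewrite in_itv /= oppr_lt0 d0.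
  by have /@derive_val -> := dF 0 t I0 t01; rewrite scale0r addr0.
have cv : h^-1 *: ((potential \o shift x) (h *: delta_mx 0 j) - potential x)
    @[h --> 0^'] --> al j x.
  rewrite -EF; apply: cvg_trans cvF; apply: near_eq_cvg; near=> h.
  by rewrite /potential /F /= addr0 scale0r addr0 [x + _]addrC.
apply: DeriveDef; first by apply/cvg_ex; exists (al j x).
exact/cvg_lim.
Unshelve. all: by end_near. Qed.

Lemma Poincare_ball :
  exists2 f, smooth B f & forall x, B x -> differential f x = alpha x.
Proof.
exists potential; last first.
  move=> x Bx; apply/rowP => j; rewrite mxE /partial.
  by have /@derive_val -> := potential_is_derive j Bx.
have dp x : B x -> derivable_at potential x.
  by move=> Bx j; have /@ex_derive := potential_is_derive j Bx.
have pp j x : B x -> al j x = partial j potential x.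
  by move=> Bx; rewrite /partial; have /@derive_val -> := potential_is_derive j Bx.
have sp j : smooth B (partial j potential).
  by apply: (smooth_congr B_open (pp j)); exact: smooth_al.
apply: smoothP => //.
(* Continuity is part of [Ck] and does not follow from the mere existence of partial derivatives; it
   comes from their continuity. *)
move=> x Bx; apply: C1_continuous.
  apply: (@near_open _ _ _ B_open x _ Bx).
 move=> y By; exact: dp.
by move=> j; exact: smooth_continuous (sp j) Bx.
Qed.

End Poincare.

(** * Local potentials of finitely many closed forms *)

Section LocalPotentials.
Context {R : realType} {n : nat}.
Variable U : set 'rV[R]_n.+1.
Hypothesis U_open : open U.
Implicit Types (x : 'rV[R]_n.+1) (alpha : 'rV[R]_n.+1 -> 'rV[R]_n.+1).

Lemma closed_form_congr alpha alpha' :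
  (forall x, U x -> alpha x = alpha' x) -> closed_form U alpha -> closed_form U alpha'.
Proof.
move=> E [sa ca]; split; first exact: smooth_mx_congr E sa.
move=> x Ux i j.
have P k l : partial k (fun y => alpha y 0 l) x = partial k (fun y => alpha' y 0 l) x.
  by apply: partial_congr Ux _ => // y /E ->.
by rewrite -!P ca.
Qed.

Lemma closed_form_subset (V : set 'rV[R]_n.+1) alpha :
  V `<=` U -> closed_form U alpha -> closed_form V alpha.
Proof.
move=> VU [sa ca]; split; first exact: smooth_mx_subset VU sa.
by move=> x /VU; exact: ca.
Qed.

Lemma closed_differential f : smooth U f -> closed_form U (differential f).
Proof.
move=> sf; have E j : (fun y => differential f y 0 j) = partial j f.
  by apply/funext => y; rewrite mxE.
split=> [i j|x Ux i j]; last by rewrite !E; exact: Schwarz (sf 2) Ux.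
by rewrite ord1 E; exact: smooth_partial.
Qed.

Lemma near_norm_le (f : 'rV[R]_n.+1 -> R) x : {for x, continuous f} ->
  \forall y \near x, `|f y| <= `|f x| + 1.
Proof.
move=> cf; apply: filterS (near_dist_le cf ltr01) => y fxy.
rewrite -[f y](subrK (f x)) (le_trans (ler_normD _ _)) // addrC lerD2l.
by rewrite distrC.
Qed.

(** By continuity all components and their first derivatives are bounded on one ball around [x0], by
    their absolute values at [x0] plus 1; finiteness of [I] gives a common ball. *)
Lemma local_potentials (I : finType) (alpha : I -> 'rV[R]_n.+1 -> 'rV[R]_n.+1) x0 :
  (forall i, closed_form U (alpha i)) -> U x0 ->
  exists V : set 'rV[R]_n.+1, [/\ open V, V x0, V `<=` U &
    exists f : I -> 'rV[R]_n.+1 -> R, forall i, smooth V (f i) /\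
      forall x, V x -> differential (f i) x = alpha i x].
Proof.
move=> ca Ux0.
have sa i j : smooth U (fun y => alpha i y 0 j) by have [+ _] := ca i; apply.
have sda i j k : smooth U (partial k (fun y => alpha i y 0 j)) by exact: smooth_partial.
have bnd : \forall y \near x0, forall i j,
    `|alpha i y 0 j| <= `|alpha i x0 0 j| + 1.
  apply: (@filter_forall _ _ _ (nbhs x0)) => i; apply: (@filter_forall _ _ _ (nbhs
    x0)) => j.
  by apply: (@near_norm_le (fun y => alpha i y 0 j)); exact: smooth_continuous Ux0.
have dbnd : \forall y \near x0, forall i j k,
    `|partial k (fun y => alpha i y 0 j) y| <= `|partial k (fun y => alpha i y 0 j)
      x0| + 1.
  apply: (@filter_forall _ _ _ (nbhs x0)) => i; apply: (@filter_forall _ _ _ (nbhs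
    x0)) => j.
  apply: (@filter_forall _ _ _ (nbhs x0)) => k.
  by apply: near_norm_le; exact: smooth_continuous Ux0.
have : \forall y \near x0, [/\ U y,
    forall i j, `|alpha i y 0 j| <= `|alpha i x0 0 j| + 1 &
    forall i j k, `|partial k (fun y => alpha i y 0 j) y|
      <= `|partial k (fun y => alpha i y 0 j) x0| + 1].
  apply: filterS3 (near_open U_open Ux0 (fun y Uy => Uy)) bnd dbnd.
  by move=> y ? ? ?; split.
move=> /near_norm_ball[r r0 xr].
have Bin y : ball x0 r y -> [/\ U y,
    forall i j, `|alpha i y 0 j| <= `|alpha i x0 0 j| + 1 &
    forall i j k, `|partial k (fun y => alpha i y 0 j) y|
      <= `|partial k (fun y => alpha i y 0 j) x0| + 1].
  by move=> /mem_ball /xr.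
have BU : ball x0 r `<=` U by move=> y /Bin[].
exists (ball x0 r); split=> //; [exact: ball_open|exact: ballxx|].
have pot i : exists f, smooth (ball x0 r) f /\
    forall x, ball x0 r x -> differential f x = alpha i x.
  have [f sf fE] := @Poincare_ball _ _ (alpha i) x0 r
    (fun j => `|alpha i x0 0 j| + 1)
    (fun j k => `|partial k (fun y => alpha i y 0 j) x0| + 1)
    (closed_form_subset BU (ca i))
    (fun j y By => let: And3 _ b _ := Bin y By in b i j)
    (fun j k y By => let: And3 _ _ c := Bin y By in c i j k).
  by exists f.
have [f fP] := choice pot.
by exists f.
Qed.

End LocalPotentials.

(** * The algebra of operators commuting with a cyclic operator *)

Section CyclicCovector.
Context {R : realType} {n : nat}.
Variables (L : 'rV[R]_n.+1 -> 'M[R]_n.+1) (x e : 'rV[R]_n.+1).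

(** For [e = df x] the rows are the coordinate differentials du^k, and invertibility is regularity
    of the conservation law. *)
Definition power_coframe : 'M[R]_n.+1 := \matrix_(k < n.+1) (e *m L x ^+ k).

(** The vector on which [e L^k] is 0 for [k < n] and 1 for [k = n]. It turns out to be cyclic for
    [L]. *)
Definition dual_vector : 'cV[R]_n.+1 := invmx power_coframe *m delta_mx ord_max 0.

(* The coefficient of [L ^+ n] in the expansion of an operator [Q] commuting
   with [L] in powers of [L]. *)
Definition lam (Q : 'M[R]_n.+1) : R := (e *m Q *m dual_vector) 0 0.

Hypothesis coframe_unit : power_coframe \in unitmx.

Local Notation xi := dual_vector.
Local Notation Lx := (L x).
Local Notation A k := (A_op L k x).
Local Notation central Q := (Q *m Lx = Lx *m Q).

Lemma lamD P Q : lam (P + Q) = lam P + lam Q.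
Proof. by rewrite /lam mulmxDr mulmxDl mxE. Qed.

Lemma lamN P : lam (- P) = - lam P.
Proof. by rewrite /lam mulmxN mulNmx mxE. Qed.

Lemma lamZ a P : lam (a *: P) = a * lam P.
Proof. by rewrite /lam -scalemxAr -scalemxAl mxE. Qed.

Lemma lam_sum (I : Type) (r : seq I) (P : I -> 'M[R]_n.+1) :
  lam (\sum_(i <- r) P i) = \sum_(i <- r) lam (P i).
Proof. by rewrite /lam mulmx_sumr mulmx_suml summxE. Qed.

Lemma lam_pow k : (k < n.+1)%N -> lam (Lx ^+ k) = (k == n)%:R.
Proof.
move=> kn.
have -> : lam (Lx ^+ k) = (row (Ordinal kn) power_coframe *m xi) 0 0.
  by rewrite rowK.
by rewrite -row_mul mulmxA mulmxV // mul1mx !mxE eqxx andbT.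
Qed.

Lemma Cayley_Hamilton_sigma :
  Lx ^+ n.+1 = \sum_(j < n.+1) sigma j.+1 Lx *: Lx ^+ (n - j).
Proof.
have := Cayley_Hamilton Lx.
rewrite -[char_poly Lx]coefK size_char_poly poly_def rmorph_sum /=.
under eq_bigr do rewrite horner_mxZ rmorphXn /= horner_mx_X.
rewrite big_ord_recr /=.
have := monicP (char_poly_monic Lx); rewrite lead_coefE size_char_poly /= => ->.
rewrite scale1r addrC => /eqP; rewrite addr_eq0 => /eqP ->.
rewrite (reindex_inj rev_ord_inj) /= -sumrN; apply: eq_bigr => j _.
by rewrite /sigma !subSS scaleNr.
Qed.

(** Induction along the recursion of [A_op]. For [j > 0] the factor [L] lowers [j] by one and the
    sigma term vanishes under [lam]. For [j = 0] Cayley-Hamilton reduces [L^(n+1)], which produces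
    exactly the sigma that the recursion subtracts. *)
Lemma lam_dual_A i (j : 'I_n.+1) :
  (i <= n)%N -> lam (Lx ^+ (n - j) *m A i) = (i == j)%:R.
Proof.
elim: i j => [|i IH] j i_le.
  rewrite /= mulmx1 lam_pow ?ltnS ?leq_subr //.
  by congr (_%:R); have := ltn_ord j; move: (val j) => k ?; lia.
rewrite /= mulmxBr lamD lamN mulmxA mul_mx_scalar lamZ.
rewrite lam_pow ?ltnS ?leq_subr // -[Lx ^+ _ *m Lx]/(Lx ^+ (n - j) * Lx) -exprSr.
have [j0|j0] := posnP j.
  rewrite j0 subn0 eqxx mulr1 Cayley_Hamilton_sigma mulmx_suml lam_sum.
  pose i' := Ordinal (ltnW i_le : i < n.+1)%N.
  rewrite (bigD1 i') //= big1.
    by rewrite addr0 -scalemxAl lamZ (IH i') ?(ltnW i_le) // eqxx mulr1 subrr.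
  move=> k; rewrite -val_eqE /= => ki.
  by rewrite -scalemxAl lamZ IH ?(ltnW i_le) // eq_sym (negbTE ki) mulr0.
have jn : (j.-1 < n.+1)%N by have := ltn_ord j; lia.
have -> : (n - j).+1 = (n - Ordinal jn)%N by have := ltn_ord j; rewrite /=; lia.
rewrite IH ?(ltnW i_le) // (_ : (n - j == n)%N = false); last by have := ltn_ord j; lia.
by rewrite mulr0 subr0 /=; congr (_%:R); lia.
Qed.

Lemma central_pow k : central (Lx ^+ k).
Proof. by rewrite !mulmxE -exprS -exprSr. Qed.

Lemma centralM P Q : central P -> central Q -> central (P *m Q).
Proof. by move=> cP cQ; rewrite -mulmxA cQ mulmxA cP mulmxA. Qed.

Lemma centralZ a P : central P -> central (a *: P).
Proof. by move=> cP; rewrite -scalemxAl cP scalemxAr. Qed.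

Lemma centralD P Q : central P -> central Q -> central (P + Q).
Proof. by move=> cP cQ; rewrite mulmxDl mulmxDr cP cQ. Qed.

Lemma centralN P : central P -> central (- P).
Proof. by move=> cP; rewrite mulNmx mulmxN cP. Qed.

Lemma central_sum (I : Type) (r : seq I) (P : I -> 'M[R]_n.+1) :
  (forall i, central (P i)) -> central (\sum_(i <- r) P i).
Proof.
by move=> cP; rewrite mulmx_suml mulmx_sumr; apply: eq_bigr => i _.
Qed.

Lemma central_lincomb (I : Type) (r : seq I) (c : I -> R) (P : I -> 'M[R]_n.+1) :
  (forall i, central (P i)) -> central (\sum_(i <- r) c i *: P i).
Proof. by move=> cP; apply: central_sum => i; apply: centralZ. Qed.

Lemma centralV P : P \in unitmx -> central P -> central (invmx P).
Proof.
move=> uP cP; apply: (can_inj (mulKmx uP)).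
by rewrite mulmxA mulmxV // mul1mx !mulmxA cP mulmxK.
Qed.

Lemma commute_A Q k : central Q -> Q *m A k = A k *m Q.
Proof.
move=> cQ; elim: k => [|k IH] /=; first by rewrite mul1mx mulmx1.
by rewrite mulmxBr mulmxBl mulmxA cQ -mulmxA IH mulmxA mul_mx_scalar mul_scalar_mx.
Qed.

Lemma central_A k : central (A k).
Proof. by rewrite -commute_A. Qed.

(** The Gram matrix [lam (P i *m Q j)] is the product of the rows [e P_i] with the columns [Q_j xi].
    If it is the identity, these matrices are inverse in the other order as well. *)
Lemma dual_rows_cols (P Q : 'I_n.+1 -> 'M[R]_n.+1) :
  (forall i j, lam (P i *m Q j) = (i == j)%:R) ->
  (\matrix_(i, j) (Q j *m xi) i 0) *m (\matrix_i (e *m P i)) = 1%:M :> 'M[R]_n.+1.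
Proof.
move=> PQ; apply: mulmx1C; apply/matrixP => i j; rewrite [RHS]mxE -PQ /lam mxE.
by rewrite mulmxA -mulmxA [RHS]mxE; apply: eq_bigr => k _; rewrite !mxE.
Qed.

Lemma dual_vec_expand (P Q : 'I_n.+1 -> 'M[R]_n.+1) X :
  (forall i j, lam (P i *m Q j) = (i == j)%:R) ->
  X = (\sum_j (e *m P j *m X) 0 0 *: Q j) *m xi.
Proof.
move=> /dual_rows_cols PQ; rewrite -[LHS]mul1mx -PQ -mulmxA mulmx_suml.
apply/matrixP => i j; rewrite ord1 summxE mxE; apply: eq_bigr => k _.
rewrite -scalemxAl [in RHS]mxE mulrC [in LHS]mxE; congr (_ * _).
by rewrite !mxE; apply: eq_bigr => l _; rewrite !mxE.
Qed.

Lemma dual_covec_expand (P Q : 'I_n.+1 -> 'M[R]_n.+1) nu :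
  (forall i j, lam (P i *m Q j) = (i == j)%:R) ->
  nu = e *m (\sum_j (nu *m Q j *m xi) 0 0 *: P j).
Proof.
move=> /dual_rows_cols PQ; rewrite -[LHS]mulmx1 -PQ mulmxA mulmx_sumr.
apply/matrixP => i j; rewrite ord1 summxE mxE; apply: eq_bigr => k _.
rewrite -scalemxAr [in RHS]mxE; congr (_ * _); last by rewrite !mxE.
by rewrite -mulmxA !mxE; apply: eq_bigr => l _; rewrite !mxE.
Qed.

(** Duality gives [D xi = 0]; since [D] commutes with the [Q_j], it kills all [Q_j xi], which form a
    basis. *)
Lemma dual_separated (P Q : 'I_n.+1 -> 'M[R]_n.+1) D :
  (forall i j, lam (P i *m Q j) = (i == j)%:R) ->
  (forall j, D *m Q j = Q j *m D) -> (forall i, lam (P i *m D) = 0) -> D = 0.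
Proof.
move=> PQ DQ PD.
have Dxi : D *m xi = 0.
  rewrite [LHS](dual_vec_expand _ PQ) big1 ?mul0mx // => j _.
  by have := PD j; rewrite /lam !mulmxA => ->; rewrite scale0r.
rewrite -[D]mulmx1 -(dual_rows_cols PQ) mulmxA (_ : D *m _ = 0) ?mul0mx //.
apply/matrixP => i j; rewrite [RHS]mxE.
have <- : (D *m (Q j *m xi)) i 0 = 0 by rewrite mulmxA DQ -mulmxA Dxi mulmx0 mxE.
by rewrite !mxE; apply: eq_bigr => k _; rewrite mxE.
Qed.

Lemma lam_pow_A (i j : 'I_n.+1) : lam (Lx ^+ (n - i) *m A j) = (i == j)%:R.
Proof. by rewrite lam_dual_A; [rewrite eq_sym|rewrite -ltnS; exact: ltn_ord]. Qed.

(** It suffices to write [P] as a combination of the [A_op L i x], which commute with every operator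
    commuting with [L]. The remainder of that expansion commutes with them too and is therefore
    separated by [lam]. *)
Lemma central_comm P Q : central P -> central Q -> P *m Q = Q *m P.
Proof.
move=> cP cQ; suff -> : P = \sum_(i < n.+1) lam (Lx ^+ (n - i) *m P) *: A i.
  rewrite mulmx_suml mulmx_sumr; apply: eq_bigr => i _.
  by rewrite -scalemxAl -scalemxAr commute_A.
apply/eqP; rewrite -subr_eq0; apply/eqP.
apply: (dual_separated (fun i j => lam_pow_A i j)).
  move=> j; apply: commute_A; apply: centralD cP (centralN _).
  by apply: central_lincomb => i; exact: central_A.
move=> j; rewrite mulmxBr lamD lamN mulmx_sumr lam_sum (bigD1 j) //= big1.
  by rewrite addr0 -scalemxAr lamZ lam_pow_A eqxx mulr1 subrr.
by move=> i /negbTE ij; rewrite -scalemxAr lamZ lam_pow_A eq_sym ij mulr0.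
Qed.

Definition dual_pair (P Q : 'I_n.+1 -> 'M[R]_n.+1) : Prop :=
  [/\ forall i, central (P i), forall i, central (Q i) &
      forall i j, lam (P i *m Q j) = (i == j)%:R].

Lemma dual_pair_A : dual_pair (fun i => Lx ^+ (n - i)) (fun i => A i).
Proof.
split=> [i|i|]; [exact: central_pow|exact: central_A|exact: lam_pow_A].
Qed.

Section DualPair.
Variables P Q : 'I_n.+1 -> 'M[R]_n.+1.
Hypothesis PQ : dual_pair P Q.

Lemma dual_pairC : dual_pair Q P.
Proof.
by case: PQ => cP cQ PQ1; split=> // i j; rewrite central_comm // PQ1 eq_sym.
Qed.

Lemma dual_expand D : central D -> D = \sum_i lam (D *m Q i) *: P i.
Proof.
move=> cD; have [cP cQ QP1] := PQ; have [_ _ PQ1] := dual_pairC.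
apply/eqP; rewrite -subr_eq0; apply/eqP.
have cS : central (\sum_i lam (D *m Q i) *: P i) by apply: central_lincomb.
apply: (dual_separated PQ1) => [j|j].
  by apply: central_comm => //; apply: centralD cD (centralN cS).
rewrite mulmxBr lamD lamN mulmx_sumr lam_sum (bigD1 j) //= big1.
  by rewrite addr0 -scalemxAr lamZ PQ1 eqxx mulr1 (central_comm cD (cQ j)) subrr.
by move=> i /negbTE ij; rewrite -scalemxAr lamZ PQ1 eq_sym ij mulr0.
Qed.

Lemma lam_separated D : central D -> (forall i, lam (D *m Q i) = 0) -> D = 0.
Proof.
by move=> cD D0; rewrite (dual_expand cD) big1 // => i _; rewrite D0 scale0r.
Qed.

Lemma dual_generates_vec X : exists2 D, central D & X = D *m xi.
Proof.
have [cP cQ PQ1] := PQ.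
by exists (\sum_j (e *m P j *m X) 0 0 *: Q j); [exact: central_lincomb|exact:
  dual_vec_expand].
Qed.

Lemma dual_generates_covec nu : exists2 D, central D & nu = e *m D.
Proof.
have [cP cQ PQ1] := PQ.
by exists (\sum_j (nu *m Q j *m xi) 0 0 *: P j); [exact: central_lincomb|exact:
  dual_covec_expand].
Qed.

(* The canonical tensor [\sum_k Q_k (x) P_k] of the algebra of operators
   commuting with [L] is symmetric. *)
Lemma dual_symmetric (nu theta : 'rV[R]_n.+1) (X Y : 'cV[R]_n.+1) :
  \sum_k (nu *m Q k *m X) 0 0 * (theta *m P k *m Y) 0 0 =
  \sum_k (nu *m Q k *m Y) 0 0 * (theta *m P k *m X) 0 0.
Proof.
have [cP cQ PQ1] := PQ.
have [N cN ->] := dual_generates_covec nu.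
have [T cT ->] := dual_generates_covec theta.
have [X' cX ->] := dual_generates_vec X.
have [Y' cY ->] := dual_generates_vec Y.
(* With all arguments written through [e] and [xi], commutativity makes the sum the expansion of
   [N V] in the [P k], paired with [T W]; exchanging [V] and [W] does not change the product. *)
have S (V W : 'M[R]_n.+1) : central V -> central W ->
    \sum_k (e *m N *m Q k *m (V *m xi)) 0 0 * (e *m T *m P k *m (W *m xi)) 0 0
    = lam (T *m W *m (N *m V)).
  move=> cV cW; rewrite [in RHS](dual_expand (centralM cN cV)) mulmx_sumr lam_sum.
  apply: eq_bigr => k _; rewrite -scalemxAr lamZ /lam !mulmxA.
  rewrite -(mulmxA _ W (P k)) (central_comm cW (cP k)) mulmxA.
  by rewrite -(mulmxA _ V (Q k)) (central_comm cV (cQ k)) mulmxA.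
rewrite !S //; congr lam.
rewrite -!mulmxA; congr (_ *m _).
rewrite !mulmxA (central_comm (centralM cY cN) cX) -!mulmxA.
by rewrite (central_comm cY cN).
Qed.

End DualPair.

Lemma linear_fun_sum (V W : lmodType R) (phi : V -> W) :
  linear phi -> forall (I : Type) (r : seq I) (c : I -> R) (v : I -> V),
  phi (\sum_(i <- r) c i *: v i) = \sum_(i <- r) c i *: phi (v i).
Proof.
move=> lin_phi I r c v; elim: r => [|i r IH]; last by rewrite !big_cons lin_phi IH.
rewrite !big_nil; apply/eqP; have /eqP := lin_phi 1 0 0.
by rewrite !scale1r addr0 -subr_eq subrr eq_sym.
Qed.

Lemma equivariant_pow (phi : 'cV[R]_n.+1 -> 'M[R]_n.+1) :
  (forall X, phi (Lx *m X) = Lx *m phi X) ->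
  forall k X, phi (Lx ^+ k *m X) = Lx ^+ k *m phi X.
Proof.
move=> phiL; elim=> [|k IH] X; first by rewrite !expr0 !mul1mx.
by rewrite !exprS -![Lx * _]/(Lx *m _) -!mulmxA phiL IH.
Qed.

Lemma equivariant_central (phi : 'cV[R]_n.+1 -> 'M[R]_n.+1) :
  linear phi -> (forall X, phi (Lx *m X) = Lx *m phi X) ->
  forall D, central D -> forall X, phi (D *m X) = D *m phi X.
Proof.
move=> lin_phi phiL D cD X; rewrite (dual_expand dual_pair_A cD) !mulmx_suml.
under eq_bigr do rewrite -scalemxAl.
rewrite (linear_fun_sum lin_phi); apply: eq_bigr => i _.
by rewrite (equivariant_pow phiL) scalemxAl.
Qed.

Definition form_comb (a : 'I_n.+1 -> 'rV[R]_n.+1) (P : 'I_n.+1 -> 'M[R]_n.+1)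
  (X : 'cV[R]_n.+1) : 'M[R]_n.+1 := \sum_k (a k *m X) 0 0 *: P k.

Lemma form_comb_linear a P : linear (form_comb a P).
Proof.
move=> c X Y; rewrite /form_comb scaler_sumr -big_split; apply: eq_bigr => k _.
by rewrite mulmxDr mxE -scalemxAr mxE scalerDl scalerA.
Qed.

Lemma form_comb_central a P X :
  (forall k, central (P k)) -> central (form_comb a P X).
Proof. by move=> cP; apply: central_lincomb. Qed.

(** Here [theta] is [lam] composed with the operator-valued form. By duality [a k] on [X] is [lam]
    of the form at [X] times [Q k], and equivariance moves [Q k] into the argument. *)
Lemma dual_forms P Q a : dual_pair P Q ->
  (forall X, form_comb a P (Lx *m X) = Lx *m form_comb a P X) ->
  forall k, a k = (\sum_i lam (P i) *: a i) *m Q k.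
Proof.
move=> PQ aL k; have [cP cQ PQ1] := PQ.
have eqv := equivariant_central (@form_comb_linear a P) aL.
set theta := \sum_i lam (P i) *: a i.
have lam_comb X : lam (form_comb a P X) = (theta *m X) 0 0.
  rewrite lam_sum mulmx_suml summxE; apply: eq_bigr => i _.
  by rewrite lamZ -scalemxAl [in RHS]mxE mulrC.
have ak (X : 'cV[R]_n.+1) : (a k *m X) 0 0 = (theta *m (Q k *m X)) 0 0.
  rewrite -lam_comb eqv // central_comm //; last exact: form_comb_central.
  rewrite mulmx_suml lam_sum (bigD1 k) //= big1.
    by rewrite addr0 -scalemxAl lamZ PQ1 eqxx mulr1.
  by move=> i /negbTE ik; rewrite -scalemxAl lamZ PQ1 ik mulr0.
apply/matrixP => i j; rewrite ord1; have := ak (delta_mx j 0).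
by rewrite mulmxA -!colE !mxE.
Qed.

(** Test both sides with [lam] against [Q i]: equality becomes the expansion of [L Q_i] in the
    [Q k], to which [theta] is applied. *)
Lemma dual_forms_conv P Q a theta : dual_pair P Q ->
  (forall k, a k = theta *m Q k) ->
  forall X, form_comb a P (Lx *m X) = Lx *m form_comb a P X.
Proof.
move=> PQ aE X; have [cP cQ PQ1] := PQ.
have cphi Y : central (form_comb a P Y) by exact: form_comb_central.
have lam_comb Y i : lam (form_comb a P Y *m Q i) = (a i *m Y) 0 0.
  rewrite mulmx_suml lam_sum (bigD1 i) //= big1.
    by rewrite addr0 -scalemxAl lamZ PQ1 eqxx mulr1.
  by move=> k /negbTE ki; rewrite -scalemxAl lamZ PQ1 ki mulr0.
apply/eqP; rewrite -subr_eq0; apply/eqP; apply: (lam_separated PQ) => [|i].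
  by apply: centralD => //; apply/centralN/centralM.
rewrite mulmxBl lamD lamN lam_comb -(cphi X) -mulmxA.
have cLQ : central (Lx *m Q i) by apply: centralM.
rewrite [in X in _ - lam X](dual_expand (dual_pairC PQ) cLQ) mulmx_sumr lam_sum.
under eq_bigr do rewrite -scalemxAr lamZ lam_comb aE.
have -> : (a i *m (Lx *m X)) 0 0 = (theta *m (Lx *m Q i) *m X) 0 0.
  by rewrite aE !mulmxA -(mulmxA theta) cQ !mulmxA.
rewrite [in X in (theta *m X *m _) 0 0](dual_expand (dual_pairC PQ) cLQ).
rewrite mulmx_sumr mulmx_suml summxE -sumrB big1 // => k _.
by rewrite -scalemxAr -scalemxAl [in X in X - _]mxE subrr.
Qed.

(* Take [Y] to be the cyclic vector [xi] in the polarized identity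
   [psi X *m Y + psi Y *m X = 0]. *)
Lemma polarization (psi : 'cV[R]_n.+1 -> 'M[R]_n.+1) :
  linear psi -> (forall X, central (psi X)) -> (forall X, psi X *m X = 0) ->
  forall X, psi X = 0.
Proof.
move=> lin_psi cpsi psi0.
have psiD X Y : psi (X + Y) = psi X + psi Y by have := lin_psi 1 X Y; rewrite !scale1r.
have sym X Y : psi X *m Y = - (psi Y *m X).
  apply/eqP; rewrite -addr_eq0; apply/eqP.
  by have := psi0 (X + Y); rewrite psiD mulmxDl !mulmxDr !psi0 addr0 add0r.
have xi_faithful D : central D -> D *m xi = 0 -> D = 0.
  move=> cD D0; apply: (lam_separated dual_pair_A cD) => i.
  by rewrite commute_A // /lam -!mulmxA D0 !mulmx0 mxE.
have psi_xi : psi xi = 0 by exact: xi_faithful (cpsi xi) (psi0 xi).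
move=> X; have [D cD ->] := dual_generates_vec dual_pair_A X.
apply: xi_faithful => //.
by rewrite sym psi_xi mul0mx oppr0.
Qed.

End CyclicCovector.

(** * Operator-valued forms and equivariance *)

Section Equivariance.
Context {R : realType} {n : nat}.
Variables (L : 'rV[R]_n.+1 -> 'M[R]_n.+1) (x e : 'rV[R]_n.+1).
Hypothesis coframe_unit : power_coframe L x e \in unitmx.
Local Notation Lx := (L x).
Local Notation central Q := (Q *m Lx = Lx *m Q).

(* [psi] is equivariant under [B] iff its defect vanishes; operators [B] which
   commute with each other have commuting defects. *)
Definition defect (B : 'M[R]_n.+1) (psi : 'cV[R]_n.+1 -> 'M[R]_n.+1) X :=
  psi (B *m X) - B *m psi X.

(* For [B = sum_j c_j L^(n-j)] this is the divided difference through which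
   [defect B] factors over [defect L]. *)
Definition kappa (c : 'I_n.+1 -> R) (psi : 'cV[R]_n.+1 -> 'M[R]_n.+1) X :=
  \sum_(j < n.+1) c j *:
    \sum_(i < n - j) Lx ^+ (n - j - i.+1) *m psi (Lx ^+ i *m X).

Lemma defect_linear B psi : linear psi -> linear (defect B psi).
Proof.
move=> lp a X Y; rewrite /defect mulmxDr -scalemxAr !lp mulmxDr -scalemxAr.
by rewrite scalerBr opprD addrACA.
Qed.

Lemma defect_central B psi X :
  central B -> (forall Y, central (psi Y)) -> central (defect B psi X).
Proof. by move=> cB cpsi; apply: centralD => //; apply/centralN/centralM. Qed.

Lemma defect_lincomb (I : Type) (r : seq I) (b : I -> R) (P : I -> 'M[R]_n.+1) psi X :
  linear psi ->
  defect (\sum_(l <- r) b l *: P l) psi X = \sum_(l <- r) b l *: defect (P l) psi X.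
Proof.
move=> lp; rewrite /defect !mulmx_suml.
under [in psi _]eq_bigr do rewrite -scalemxAl.
rewrite (linear_fun_sum lp) -sumrB; apply: eq_bigr => l _.
by rewrite scalerBr scalemxAl.
Qed.

(** The identity for [a^k - b^k] divided by [a - b], with [L] acting on the argument as [a] and on
    the value as [b]. *)
Lemma defect_pow k psi X : linear psi ->
  \sum_(i < k) Lx ^+ (k - i.+1) *m defect Lx psi (Lx ^+ i *m X)
  = defect (Lx ^+ k) psi X.
Proof.
move=> lp; pose F i := Lx ^+ (k - i) *m psi (Lx ^+ i *m X).
transitivity (\sum_(i < k) (F i.+1 - F i)).
  apply: eq_bigr => i _; rewrite /defect /F mulmxBr !mulmxA.
  by rewrite !mulmxE -exprS -exprSr -subSn ?ltn_ord // subSS.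
rewrite -(big_mkord xpredT (fun i => F i.+1 - F i)) telescope_sumr //.
by rewrite /F subnn subn0 !expr0 !mul1mx.
Qed.

Lemma kappa_defect c psi X : linear psi ->
  kappa c (defect Lx psi) X = defect (\sum_j c j *: Lx ^+ (n - j)) psi X.
Proof.
move=> lp; rewrite defect_lincomb //; apply: eq_bigr => j _.
by rewrite defect_pow.
Qed.

Lemma kappa_linear c psi : linear psi -> linear (kappa c psi).
Proof.
move=> lp a X Y; rewrite /kappa scaler_sumr -big_split; apply: eq_bigr => j _ /=.
rewrite scalerA mulrC -scalerA -scalerDr; congr (_ *: _).
rewrite scaler_sumr -big_split; apply: eq_bigr => i _ /=.
by rewrite mulmxDr -scalemxAr lp mulmxDr -scalemxAr.
Qed.

Lemma defect_kappa B c psi X : central B ->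
  defect B (kappa c psi) X = kappa c (defect B psi) X.
Proof.
move=> cB; have cBk k : B *m Lx ^+ k = Lx ^+ k *m B.
  by apply: (central_comm coframe_unit) => //; exact: central_pow.
rewrite /defect /kappa mulmx_sumr -sumrB; apply: eq_bigr => j _.
rewrite -scalemxAr -scalerBr mulmx_sumr -sumrB; congr (_ *: _); apply: eq_bigr => i _.
by rewrite mulmxBr !mulmxA -!cBk.
Qed.

Lemma defect_equivariant B psi X : central B -> linear psi ->
  (forall Y, defect Lx psi Y = 0) -> defect B psi X = 0.
Proof.
move=> cB lp psi0; apply/eqP; rewrite subr_eq0; apply/eqP.
apply: (equivariant_central coframe_unit lp) => // Y.
by apply/eqP; rewrite -subr_eq0; apply/eqP; exact: psi0.
Qed.

Lemma linear_fun_sub (phi psi : 'cV[R]_n.+1 -> 'M[R]_n.+1) :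
  linear phi -> linear psi -> linear (fun X => phi X - psi X).
Proof. by move=> l1 l2 a X Y; rewrite l1 l2 scalerBr opprD addrACA. Qed.

(* If [defect L phi_a = defect A gamma] and [defect L phi_b = defect B gamma],
   then [defect A phi_b] and [defect B phi_a] both equal
   [defect B (kappa a gamma)]. *)
Lemma defect_exchange (a : 'I_n.+1 -> R) A B phia phib gamma X :
  A = \sum_j a j *: Lx ^+ (n - j) -> central B ->
  linear phia -> linear phib -> linear gamma ->
  (forall Y, defect Lx phia Y = defect A gamma Y) ->
  (forall Y, defect Lx phib Y = defect B gamma Y) ->
  defect A phib X = defect B phia X.
Proof.
move=> AE cB la lb lg Da Db.
transitivity (defect B (kappa a gamma) X).
  rewrite AE -kappa_defect // defect_kappa // /kappa.
  by apply: eq_bigr => j _; congr (_ *: _); apply: eq_bigr => i _; rewrite Db.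
apply/eqP; rewrite -subr_eq0; apply/eqP.
have -> : defect B (kappa a gamma) X - defect B phia X
    = defect B (fun Y => kappa a gamma Y - phia Y) X.
  by rewrite /defect mulmxBr; apply/matrixP => i j; rewrite !mxE; ring.
apply: defect_equivariant => //.
  by apply: linear_fun_sub => //; exact: kappa_linear.
move=> Y; have cL : central Lx by [].
have E1 : defect Lx (kappa a gamma) Y = defect A gamma Y.
  by rewrite defect_kappa // kappa_defect // AE.
move: E1; rewrite -Da /defect mulmxBr => /eqP; rewrite -subr_eq0 => /eqP E1.
by rewrite -[RHS]E1; apply/matrixP => i j; rewrite !mxE; ring.
Qed.

End Equivariance.

Lemma free_rows_unit (F : fieldType) m (A : 'M[F]_m) :
  (forall w : 'rV[F]_m, w *m A = 0 -> w = 0) -> A \in unitmx.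
Proof.
move=> A0; rewrite -row_free_unit -kermx_eq0; apply/eqP/row_matrixP => i.
by rewrite row0; apply: A0; rewrite -row_mul mulmx_ker row0.
Qed.

(** * From the quadratic forms to the Killing tensors at a point *)

Section QuadraticForms.
Context {R : realType} {n : nat}.
Variables (L : 'rV[R]_n.+1 -> 'M[R]_n.+1) (x e : 'rV[R]_n.+1).
Hypothesis coframe_unit : power_coframe L x e \in unitmx.
Local Notation Lx := (L x).
Local Notation central Q := (Q *m Lx = Lx *m Q).
Local Notation lamx := (lam L x e).
Variables (M T : 'I_n.+1 -> 'M[R]_n.+1).
Hypothesis MT : dual_pair L x e M T.
Variables (h : 'I_n.+1 -> 'rV[R]_n.+1 -> R) (g : 'M[R]_n.+1)
  (K : 'I_n.+1 -> 'M[R]_n.+1).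
Hypothesis hE : forall D, central D -> \sum_i h i (e *m D) *: M i = D *m D.
Hypothesis g_sym : g^T = g.
Hypothesis g_unit : g \in unitmx.
Hypothesis h0 : forall xi : 'rV[R]_n.+1, h ord0 xi = 2^-1 * (xi *m g *m xi^T) 0 0.
Hypothesis K_adj : forall i (xi eta : 'rV[R]_n.+1),
  (xi *m K i *m g *m eta^T) 0 0 = (xi *m g *m (eta *m K i)^T) 0 0.
Hypothesis hi : forall i (xi : 'rV[R]_n.+1), h i xi = 2^-1 * (xi *m K i *m g *m xi^T)
  0 0.

Lemma h_lam i D : central D -> h i (e *m D) = lamx (D *m D *m T i).
Proof.
move=> cD; have [cM cT MT1] := MT.
rewrite -hE // mulmx_suml lam_sum (bigD1 i) //= big1.
  by rewrite addr0 -scalemxAl lamZ MT1 eqxx mulr1.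
by move=> j /negbTE ji; rewrite -scalemxAl lamZ MT1 ji mulr0.
Qed.

Lemma symmetric_form_eq (b1 b2 : 'rV[R]_n.+1 -> 'rV[R]_n.+1 -> R) :
  (forall u v w, b1 (u + v) w = b1 u w + b1 v w) ->
  (forall u v, b1 u v = b1 v u) ->
  (forall u v w, b2 (u + v) w = b2 u w + b2 v w) ->
  (forall u v, b2 u v = b2 v u) ->
  (forall u, b1 u u = b2 u u) -> forall u v, b1 u v = b2 u v.
Proof.
move=> l1 s1 l2 s2 q u v.
have pol (b : 'rV[R]_n.+1 -> 'rV[R]_n.+1 -> R) :
    (forall u v w, b (u + v) w = b u w + b v w) -> (forall u v, b u v = b v u) ->
    b (u + v) (u + v) = b u u + b v v + 2 * b u v.
  by move=> l s; rewrite l (s u) (s v) !l (s v u); ring.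
have := q (u + v); rewrite (pol _ l1 s1) (pol _ l2 s2) !q => /addrI.
by apply: mulfI; rewrite pnatr_eq0.
Qed.

Lemma form_mx_inj (A B : 'M[R]_n.+1) :
  (forall u v : 'rV[R]_n.+1, (u *m A *m v^T) 0 0 = (u *m B *m v^T) 0 0) -> A = B.
Proof.
move=> AB; apply/matrixP => i j.
have := AB (delta_mx 0 i) (delta_mx 0 j).
by rewrite !trmx_delta -!rowE -!colE !mxE.
Qed.

Lemma covec_inj D D' : central D -> central D' -> e *m D = e *m D' -> D = D'.
Proof.
move=> cD cD' eD; apply/eqP; rewrite -subr_eq0; apply/eqP.
apply: (lam_separated coframe_unit MT) => [|i].
  by apply: centralD => //; exact: centralN.
by rewrite /lam mulmxA mulmxBr eD subrr !mul0mx mxE.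
Qed.

(** Both sides are symmetric and biadditive in the covectors [e D] and [e D'], so polarization
    reduces them to the diagonal, where both are given by [h i]. It is applied to [G = g] and to
    [G = K i *m g]. *)
Lemma quadratic_lam i (G : 'M[R]_n.+1) :
  (forall xi : 'rV[R]_n.+1, h i xi = 2^-1 * (xi *m G *m xi^T) 0 0) -> G^T = G ->
  forall D D', central D -> central D' ->
  (e *m D *m G *m (e *m D')^T) 0 0 = 2 * lamx (D *m D' *m T i).
Proof.
move=> hG symG; have [cM cT MT1] := MT.
(* The inverse of [D |-> e D], given by a formula so that additivity is visible. *)
pose Du (u : 'rV[R]_n.+1) := \sum_j (u *m T j *m dual_vector L x e) 0 0 *: M j.
have cDu u : central (Du u) by exact: central_lincomb.
have eDu u : u = e *m Du u by exact: dual_covec_expand.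
have DuD u v : Du (u + v) = Du u + Du v.
  rewrite /Du -big_split; apply: eq_bigr => j _ /=.
  by rewrite !mulmxDl mxE scalerDl.
have DuE D : central D -> Du (e *m D) = D.
  by move=> cD; apply: covec_inj => //; rewrite -eDu.
move=> D D' cD cD'; rewrite -[in RHS](DuE D cD) -[in RHS](DuE D' cD').
apply: (symmetric_form_eq (b1 := fun u v => (u *m G *m v^T) 0 0)
  (b2 := fun u v => 2 * lamx (Du u *m Du v *m T i))).
- by move=> u v w; rewrite !mulmxDl mxE.
- move=> u v; rewrite -[u *m G *m v^T]trmxK [in LHS]mxE !trmx_mul trmxK symG mulmxA;
  exact: erefl.
- by move=> u v w; rewrite DuD !mulmxDl lamD mulrDr.
- by move=> u v; rewrite (central_comm coframe_unit (cDu u) (cDu v)).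
- by move=> u; rewrite -h_lam // -eDu hG mulrA divff ?mul1r // pnatr_eq0.
Qed.

Lemma Kg_sym i : (K i *m g)^T = K i *m g.
Proof.
rewrite trmx_mul g_sym; apply: form_mx_inj => u v.
by rewrite !mulmxA K_adj trmx_mul !mulmxA.
Qed.

(** If [w = e D] is killed by [T ord0], the metric pairs it with every [e D'] to
    [2 lam (D D' T_0) = 0], so [w = 0] by non-degeneracy. *)
Lemma T0_unit : T ord0 \in unitmx.
Proof.
have [cM cT MT1] := MT.
apply: free_rows_unit => w wT; have [D cD wE] := dual_generates_covec MT w.
suff wg : w *m g = 0 by rewrite -[w](mulmxK g_unit) wg mul0mx.
apply/rowP => j.
have [D' cD' jE] := dual_generates_covec MT (delta_mx 0 j).
have := quadratic_lam h0 g_sym cD cD'.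
rewrite -wE -jE trmx_delta -colE mxE => ->.
rewrite /lam -(mulmxA D) (central_comm coframe_unit cD' (cT _)) !mulmxA.
by rewrite -wE wT !mul0mx !mxE mulr0.
Qed.

(** Lowered by the invertible [g], both operators give the bilinear form [2 lam (D D' T_i)] on the
    covectors [e D], [e D']. *)
Lemma K_lam i : K i = T i *m invmx (T ord0).
Proof.
have [cM cT MT1] := MT; have T0u := T0_unit.
apply: (can_inj (mulmxK g_unit)); apply: form_mx_inj => u v.
have [D cD ->] := dual_generates_covec MT u.
have [D' cD' ->] := dual_generates_covec MT v.
have cV : central (invmx (T ord0)) by exact: centralV.
have hKg xi : h i xi = 2^-1 * (xi *m (K i *m g) *m xi^T) 0 0 by rewrite hi mulmxA.
rewrite (quadratic_lam hKg (Kg_sym i) cD cD') !mulmxA.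
have cDT : central (D *m T i *m invmx (T ord0)) by rewrite !centralM ?cD.
have := quadratic_lam h0 g_sym cDT cD'; rewrite !mulmxA => ->.
congr (_ * lamx _); rewrite -!mulmxA; congr (D *m _).
rewrite (central_comm coframe_unit cD' (cT ord0)) (mulmxA (invmx _)) mulVmx // mul1mx.
by rewrite (central_comm coframe_unit cD' (cT i)).
Qed.

End QuadraticForms.

(** * Derivatives of matrix-valued functions *)

Section MatrixDerivative.
Context {R : realType} {n : nat}.
Implicit Types (x : 'rV[R]_n.+1) (v : 'cV[R]_n.+1).

Definition derivable_mx p q (A : 'rV[R]_n.+1 -> 'M[R]_(p, q)) x :=
  forall i j, derivable_at (fun y => A y i j) x.

Definition Dmx p q (A : 'rV[R]_n.+1 -> 'M[R]_(p, q)) x v : 'M[R]_(p, q) :=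
  \matrix_(i, j) \sum_k v k 0 * partial k (fun y => A y i j) x.

Definition Dfun (f : 'rV[R]_n.+1 -> R) x v : R := (differential f x *m v) 0 0.

Lemma DfunE (f : 'rV[R]_n.+1 -> R) x v :
  Dfun f x v = \sum_k v k 0 * partial k f x.
Proof. by rewrite /Dfun mxE; apply: eq_bigr => k _; rewrite !mxE mulrC. Qed.

Lemma DmxE p q (A : 'rV[R]_n.+1 -> 'M[R]_(p, q)) x v i j :
  Dmx A x v i j = Dfun (fun y => A y i j) x v.
Proof. by rewrite mxE DfunE. Qed.

Section AtPoint.
Variable x : 'rV[R]_n.+1.

Lemma DfunD_dir f v w : Dfun f x (v + w) = Dfun f x v + Dfun f x w.
Proof. by rewrite /Dfun mulmxDr mxE. Qed.

Lemma DfunZ_dir f a v : Dfun f x (a *: v) = a * Dfun f x v.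
Proof. by rewrite /Dfun -scalemxAr mxE. Qed.

Lemma Dfun_sum_dir f (I : Type) (r : seq I) (v : I -> 'cV[R]_n.+1) :
  Dfun f x (\sum_(i <- r) v i) = \sum_(i <- r) Dfun f x (v i).
Proof. by rewrite /Dfun mulmx_sumr summxE. Qed.

Lemma DfunM f g v : derivable_at f x -> derivable_at g x ->
  Dfun (fun y => f y * g y) x v = f x * Dfun g x v + Dfun f x v * g x.
Proof.
move=> df dg; rewrite !DfunE mulr_sumr mulr_suml -big_split.
by apply: eq_bigr => k _ /=; rewrite partialM // mulrDr mulrCA [v k 0 * (_ * g x)]mulrA.
Qed.

Lemma DfunD f g v : derivable_at f x -> derivable_at g x ->
  Dfun (fun y => f y + g y) x v = Dfun f x v + Dfun g x v.
Proof.
move=> df dg; rewrite !DfunE -big_split.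
by apply: eq_bigr => k _ /=; rewrite partialD // mulrDr.
Qed.

Lemma DfunN f v : derivable_at f x -> Dfun (fun y => - f y) x v = - Dfun f x v.
Proof.
move=> df; rewrite !DfunE -sumrN.
by apply: eq_bigr => k _; rewrite partialN // mulrN.
Qed.

Lemma Dfun_cst a v : Dfun (fun=> a) x v = 0.
Proof. by rewrite DfunE big1 // => k _; rewrite partial_cst mulr0. Qed.

Lemma Dfun_sum (I : Type) (r : seq I) (F : I -> 'rV[R]_n.+1 -> R) v :
  (forall i, derivable_at (F i) x) ->
  Dfun (fun y => \sum_(i <- r) F i y) x v = \sum_(i <- r) Dfun (F i) x v.
Proof.
move=> dF; rewrite DfunE; under [RHS]eq_bigr do rewrite DfunE.
rewrite exchange_big; apply: eq_bigr => k _ /=.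
by rewrite partial_sum // mulr_sumr.
Qed.

Lemma derivable_mxM p q r (A : 'rV[R]_n.+1 -> 'M[R]_(p, q))
    (B : 'rV[R]_n.+1 -> 'M[R]_(q, r)) :
  derivable_mx A x -> derivable_mx B x -> derivable_mx (fun y => A y *m B y) x.
Proof.
move=> dA dB i j.
rewrite (_ : (fun y => _) = fun y => \sum_k A y i k * B y k j); last first.
  by apply/funext => y; rewrite mxE.
by apply: derivable_sum_at => k; exact: derivableM_at (dA i k) (dB k j).
Qed.

Lemma derivable_mxZ p q f (A : 'rV[R]_n.+1 -> 'M[R]_(p, q)) :
  derivable_at f x -> derivable_mx A x -> derivable_mx (fun y => f y *: A y) x.
Proof.
move=> df dA i j.
rewrite (_ : (fun y => _) = fun y => f y * A y i j).
  exact: derivableM_at df (dA i j).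
by apply/funext => y; rewrite mxE.
Qed.

Lemma derivable_mx_cst p q (A : 'M[R]_(p, q)) : derivable_mx (fun=> A) x.
Proof. by move=> i j; exact: derivable_cst_at. Qed.

Lemma derivable_mx_scalar m f :
  derivable_at f x -> derivable_mx (fun y => (f y)%:M : 'M[R]_m) x.
Proof.
move=> df; rewrite (_ : (fun y => _) = fun y => f y *: 1%:M).
  exact: derivable_mxZ df (@derivable_mx_cst _ _ _).
by apply/funext => y; rewrite scalemx1.
Qed.

Lemma DmxM p q r (A : 'rV[R]_n.+1 -> 'M[R]_(p, q))
    (B : 'rV[R]_n.+1 -> 'M[R]_(q, r)) v :
  derivable_mx A x -> derivable_mx B x ->
  Dmx (fun y => A y *m B y) x v = A x *m Dmx B x v + Dmx A x v *m B x.
Proof.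
move=> dA dB; apply/matrixP => i j; rewrite DmxE !mxE -big_split.
rewrite (_ : (fun y => _) = fun y => \sum_k A y i k * B y k j); last first.
  by apply/funext => y; rewrite mxE.
rewrite Dfun_sum; last by move=> k; exact: derivableM_at (dA i k) (dB k j).
by apply: eq_bigr => k _; rewrite (DfunM v (dA i k) (dB k j)) !DmxE.
Qed.

Lemma DmxZ p q f (A : 'rV[R]_n.+1 -> 'M[R]_(p, q)) v :
  derivable_at f x -> derivable_mx A x ->
  Dmx (fun y => f y *: A y) x v = f x *: Dmx A x v + Dfun f x v *: A x.
Proof.
move=> df dA; apply/matrixP => i j; rewrite DmxE.
rewrite (_ : (fun y => _) = fun y => f y * A y i j); last first.
  by apply/funext => y; rewrite mxE.
by rewrite (DfunM v df (dA i j)) [in RHS]mxE; congr (_ + _); rewrite mxE // DmxE.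
Qed.

Lemma Dmx_sum p q (I : Type) (r : seq I) (F : I -> 'rV[R]_n.+1 -> 'M[R]_(p, q)) v :
  (forall i, derivable_mx (F i) x) ->
  Dmx (fun y => \sum_(i <- r) F i y) x v = \sum_(i <- r) Dmx (F i) x v.
Proof.
move=> dF; apply/matrixP => i j; rewrite DmxE summxE.
rewrite (_ : (fun y => _) = fun y => \sum_(k <- r) F k y i j); last first.
  by apply/funext => y; rewrite summxE.
by rewrite Dfun_sum; [apply: eq_bigr => k _; rewrite DmxE|move=> k; apply: dF].
Qed.

Lemma Dmx_cst p q (A : 'M[R]_(p, q)) v : Dmx (fun=> A) x v = 0.
Proof. by apply/matrixP => i j; rewrite DmxE Dfun_cst mxE. Qed.

Lemma DmxD_dir p q (A : 'rV[R]_n.+1 -> 'M[R]_(p, q)) v w :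
  Dmx A x (v + w) = Dmx A x v + Dmx A x w.
Proof. by apply/matrixP => i j; rewrite [in RHS]mxE !DmxE DfunD_dir. Qed.

Lemma DmxZ_dir p q (A : 'rV[R]_n.+1 -> 'M[R]_(p, q)) a v :
  Dmx A x (a *: v) = a *: Dmx A x v.
Proof. by apply/matrixP => i j; rewrite [in RHS]mxE !DmxE DfunZ_dir. Qed.

Lemma Dmx_sum_dir p q (A : 'rV[R]_n.+1 -> 'M[R]_(p, q)) (I : Type) (r : seq I)
    (v : I -> 'cV[R]_n.+1) :
  Dmx A x (\sum_(i <- r) v i) = \sum_(i <- r) Dmx A x (v i).
Proof.
by apply/matrixP => i j; rewrite summxE DmxE Dfun_sum_dir; apply: eq_bigr => k _;
  rewrite DmxE.
Qed.

Lemma lie_bracketE (X Y : 'rV[R]_n.+1 -> 'cV[R]_n.+1) :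
  lie_bracket X Y x = Dmx Y x (X x) - Dmx X x (Y x).
Proof. by apply/matrixP => i j; rewrite ord1 !mxE -sumrB. Qed.

End AtPoint.

Lemma smooth_derivable_mx (U : set 'rV[R]_n.+1) p q
    (A : 'rV[R]_n.+1 -> 'M[R]_(p, q)) x :
  smooth_mx U A -> U x -> derivable_mx A x.
Proof. by move=> sA Ux i j; apply: smooth_derivable (sA i j) Ux. Qed.

Lemma Dmx_congr (U : set 'rV[R]_n.+1) p q
    (A B : 'rV[R]_n.+1 -> 'M[R]_(p, q)) x v :
  open U -> U x -> (forall y, U y -> A y = B y) -> Dmx A x v = Dmx B x v.
Proof.
move=> Uo Ux AB; apply/matrixP => i j; rewrite !mxE; apply: eq_bigr => k _.
by rewrite (@partial_congr _ _ _ Uo _ (fun y => B y i j) k _ Ux) // => y /AB ->.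
Qed.

End MatrixDerivative.

(** * The bracket of two operator fields as a tensor *)

Section PairBracket.
Context {R : realType} {n : nat}.
Implicit Types (A B C L : 'rV[R]_n.+1 -> 'M[R]_n.+1).
Variable x : 'rV[R]_n.+1.

(* The value of [pair_bracket A B X Y] for commuting [A] and [B]: the derivatives
   of the vector fields [X] and [Y] cancel. *)
Definition Tpair A B (X Y : 'cV[R]_n.+1) : 'cV[R]_n.+1 :=
  Dmx B x (A x *m X) *m Y - A x *m Dmx B x X *m Y
  - Dmx A x (B x *m Y) *m X + B x *m Dmx A x Y *m X.

Lemma pair_bracketE A B (X Y : 'rV[R]_n.+1 -> 'cV[R]_n.+1) :
  derivable_mx A x -> derivable_mx B x -> derivable_mx X x -> derivable_mx Y x ->
  A x *m B x = B x *m A x ->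
  pair_bracket A B X Y x = Tpair A B (X x) (Y x).
Proof.
move=> dA dB dX dY AB; rewrite /pair_bracket !lie_bracketE /op_app !DmxM //.
rewrite /Tpair !mulmxDr !mulmxN !mulmxDr !mulmxA AB !opprD !opprK.
set a := Dmx B x _ *m Y x; set b := A x *m Dmx B x _ *m Y x.
set c := Dmx A x (B x *m Y x) *m _; set d := B x *m _ *m X x.
set e := B x *m A x *m Dmx Y x _; set f := B x *m A x *m Dmx X x _.
set g := B x *m Dmx Y x _; set h := A x *m Dmx X x _.
apply/matrixP => i j; rewrite !mxE; ring.
Qed.

Lemma Tpair_opp A B X Y : Tpair A B X Y = - Tpair B A Y X.
Proof. by rewrite /Tpair; apply/matrixP => i j; rewrite !mxE; ring. Qed.

Lemma TpairM A B C X Y :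
  derivable_mx B x -> derivable_mx C x ->
  A x *m B x = B x *m A x -> 
  Tpair A (fun y => B y *m C y) X Y
    = Tpair A B X (C x *m Y) + B x *m Tpair A C X Y.
Proof.
move=> dB dC AB; rewrite /Tpair !DmxM // !mulmxDl !mulmxDr !mulmxN !mulmxDl !mulmxA AB.
by apply/matrixP => i j; rewrite !mxE; ring.
Qed.

Lemma TpairZ A B f X Y :
  derivable_at f x -> derivable_mx B x ->
  Tpair A (fun y => f y *: B y) X Y = f x *: Tpair A B X Y
    + (Dfun f x (A x *m X) *: B x - Dfun f x X *: (A x *m B x)) *m Y.
Proof.
move=> df dB; rewrite /Tpair !DmxZ // !(mulmxDl, mulmxDr, mulNmx, mulmxN).
rewrite -!(scalemxAl, scalemxAr) DmxZ_dir -!scalemxAl !scalerDr !scalerN.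
by apply/matrixP => i j; rewrite !mxE; ring.
Qed.

Lemma Tpair_sum A (I : Type) (r : seq I) (B : I -> 'rV[R]_n.+1 -> 'M[R]_n.+1) X Y :
  (forall i, derivable_mx (B i) x) ->
  Tpair A (fun y => \sum_(i <- r) B i y) X Y = \sum_(i <- r) Tpair A (B i) X Y.
Proof.
move=> dB; rewrite /Tpair !Dmx_sum // !mulmx_suml Dmx_sum_dir mulmx_sumr.
by rewrite !mulmx_suml -!sumrN -!big_split.
Qed.

Lemma Tpair_lincomb A (I : Type) (r : seq I) (f : I -> 'rV[R]_n.+1 -> R)
    (B : I -> 'rV[R]_n.+1 -> 'M[R]_n.+1) X Y :
  (forall i, derivable_at (f i) x) -> (forall i, derivable_mx (B i) x) ->
  Tpair A (fun y => \sum_(i <- r) f i y *: B i y) X Y =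
    \sum_(i <- r) f i x *: Tpair A (B i) X Y
    + (\sum_(i <- r) (Dfun (f i) x (A x *m X) *: B i x
                      - Dfun (f i) x X *: (A x *m B i x))) *m Y.
Proof.
move=> df dB; rewrite Tpair_sum; last by move=> i; exact: derivable_mxZ.
by rewrite mulmx_suml -big_split; apply: eq_bigr => i _; exact: TpairZ.
Qed.

Lemma Tpair_congr (U : set 'rV[R]_n.+1) A A' B B' X Y :
  open U -> U x -> (forall y, U y -> A y = A' y) -> (forall y, U y -> B y = B' y) ->
  Tpair A B X Y = Tpair A' B' X Y.
Proof.
move=> Uo Ux AA BB; rewrite /Tpair (AA x Ux) (BB x Ux).
by rewrite !(Dmx_congr _ Uo Ux AA) !(Dmx_congr _ Uo Ux BB).
Qed.

End PairBracket.

(** * Symmetries and linear combinations in terms of the tensor *)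

Section Symmetries.
Context {R : realType} {n : nat}.
Variable U : set 'rV[R]_n.+1.
Hypothesis U_open : open U.
Implicit Types (A B L : 'rV[R]_n.+1 -> 'M[R]_n.+1) (X Y : 'cV[R]_n.+1).

(** Constant fields realise every pair of vectors at [x], so a condition on all smooth fields yields
    the vanishing of the tensor. *)
Lemma pair_bracket_const A B x X Y :
  smooth_mx U A -> smooth_mx U B -> U x -> A x *m B x = B x *m A x ->
  pair_bracket A B (fun=> X) (fun=> Y) x = Tpair x A B X Y.
Proof.
move=> sA sB Ux AB; exact: (@pair_bracketE _ _ _ _ _ (fun=> X) (fun=> Y)
  (smooth_derivable_mx sA Ux) (smooth_derivable_mx sB Ux)
  (@derivable_mx_cst _ _ x _ _ X) (@derivable_mx_cst _ _ x _ _ Y) AB).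
Qed.

Lemma nijenhuis_torsionE L (X Y : 'rV[R]_n.+1 -> 'cV[R]_n.+1) x :
  nijenhuis_torsion L X Y x = pair_bracket L L X Y x.
Proof.
have E : L x ^+ 2 = L x *m L x by exact: expr2.
by rewrite /nijenhuis_torsion E addrAC.
Qed.

Lemma nijenhuis_Tpair L x X Y : nijenhuis U L -> U x -> Tpair x L L X Y = 0.
Proof.
move=> [sL NL] Ux; rewrite -(pair_bracket_const X Y sL sL Ux) //.
rewrite -nijenhuis_torsionE; apply: NL => //; exact: smooth_mx_cst.
Qed.

Lemma Sym_Tpair L A x X Y : Sym U L A -> U x -> Tpair x L A X Y = 0.
Proof.
move=> [sL sA LA T0] Ux; rewrite -(pair_bracket_const X Y sL sA Ux); last exact: LA.
by apply: T0 => //; exact: smooth_mx_cst.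
Qed.

Lemma Tpair_Sym L A : smooth_mx U L -> smooth_mx U A -> commuting U L A ->
  (forall x X Y, U x -> Tpair x L A X Y = 0) -> Sym U L A.
Proof.
move=> sL sA LA T0; split=> // X Y sX sY x Ux.
by rewrite pair_bracketE ?T0 //; [exact: smooth_derivable_mx Ux..|exact: LA].
Qed.

Lemma Tpair_symmetries A B : smooth_mx U A -> smooth_mx U B -> commuting U A B ->
  (forall x X, U x -> Tpair x A B X X = 0) -> symmetries U A B.
Proof.
move=> sA sB AB T0; split=> // X sX x Ux.
by rewrite pair_bracketE ?T0 //; [exact: smooth_derivable_mx Ux..|exact: AB].
Qed.

Lemma symmetries_Tpair A B x X : symmetries U A B -> U x -> Tpair x A B X X = 0.
Proof.
move=> [sA sB AB T0] Ux; rewrite -(pair_bracket_const X X sA sB Ux); last exact: AB.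
by apply: T0 => //; exact: smooth_mx_cst.
Qed.

Definition diffs (a : 'I_n.+1 -> 'rV[R]_n.+1 -> R) x k : 'rV[R]_n.+1 :=
  differential (a k) x.

Lemma Tpair_comb A (b : 'I_n.+1 -> 'rV[R]_n.+1 -> R)
    (P : 'I_n.+1 -> 'rV[R]_n.+1 -> 'M[R]_n.+1) B x X Y :
  (forall l, smooth U (b l)) -> (forall l, smooth_mx U (P l)) -> U x ->
  (forall y, U y -> B y = \sum_l b l y *: P l y) ->
  Tpair x A B X Y = \sum_l b l x *: Tpair x A (P l) X Y
    + defect (A x) (form_comb (diffs b x) (P^~ x)) X *m Y.
Proof.
move=> sb sP Ux BE.
rewrite (@Tpair_congr _ _ _ U A A B (fun y => \sum_l b l y *: P l y)) //.
rewrite Tpair_lincomb; first last.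
- by move=> l; exact: smooth_derivable_mx Ux.
- by move=> l; exact: smooth_derivable Ux.
congr (_ + _ *m Y); rewrite /defect /form_comb mulmx_sumr -sumrB.
by apply: eq_bigr => l _; rewrite -scalemxAr.
Qed.

(** Expand [B], then exchange the two slots by [Tpair_opp] and expand [A] by the same rule; this is
    why the second defect is taken at [Y] and acts on [X]. *)
Lemma Tpair_comb2 (a b : 'I_n.+1 -> 'rV[R]_n.+1 -> R)
    (P : 'I_n.+1 -> 'rV[R]_n.+1 -> 'M[R]_n.+1) A B x X Y :
  (forall l, smooth U (a l)) -> (forall l, smooth U (b l)) ->
  (forall l, smooth_mx U (P l)) -> U x ->
  (forall k l X Y, Tpair x (P k) (P l) X Y = 0) ->
  (forall y, U y -> A y = \sum_l a l y *: P l y) ->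
  (forall y, U y -> B y = \sum_l b l y *: P l y) ->
  Tpair x A B X Y = defect (A x) (form_comb (diffs b x) (P^~ x)) X *m Y
    - defect (B x) (form_comb (diffs a x) (P^~ x)) Y *m X.
Proof.
move=> sa sb sP Ux PP AE BE; rewrite (Tpair_comb A X Y sb sP Ux BE) addrC.
congr (_ + _).
set phi := form_comb (diffs a x) _.
have E l : Tpair x A (P l) X Y = - (defect (P l x) phi Y *m X).
  rewrite Tpair_opp (Tpair_comb (P l) Y X sa sP Ux AE) big1 ?add0r // => k _.
  by rewrite PP scaler0.
under eq_bigr do rewrite E.
rewrite (BE x Ux) defect_lincomb; last exact: form_comb_linear.
rewrite mulmx_suml -sumrN; apply: eq_bigr => l _.
by rewrite scalerN scalemxAl.
Qed.

Lemma Tpair_pow L B k x X Y :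
  smooth_mx U L -> U x -> B x *m L x = L x *m B x ->
  (forall X Y, Tpair x B L X Y = 0) ->
  Tpair x B (fun y => L y ^+ k) X Y = 0.
Proof.
move=> sL Ux BL T0; have dL : derivable_mx L x by exact: smooth_derivable_mx Ux.
elim: k X Y => [|k IH] X Y.
  rewrite (_ : (fun y => _) = fun=> 1%:M) //.
  rewrite /Tpair !Dmx_cst !mul0mx mulmx0 mul0mx subr0 !mul1mx.
  by rewrite sub0r addrC subrr.
rewrite (_ : (fun y => _) = fun y => L y *m L y ^+ k); last first.
  by apply/funext => y; rewrite exprS.
have dLk : derivable_mx (fun y => L y ^+ k) x.
  by apply: smooth_derivable_mx Ux; exact: smooth_mxX.
by rewrite (TpairM _ _ dL dLk BL) T0 IH mulmx0 addr0.
Qed.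

(** The Nijenhuis condition is the case [k = l = 1]; the Leibniz rule raises the exponent in one
    slot, and [Tpair_opp] transfers this to the other. *)
Lemma Tpair_powers L k l x X Y : nijenhuis U L -> U x ->
  Tpair x (fun y => L y ^+ k) (fun y => L y ^+ l) X Y = 0.
Proof.
move=> NL Ux; have [sL _] := NL.
apply: Tpair_pow => //.
  by rewrite !mulmxE -exprS -exprSr.
move=> X' Y'; rewrite Tpair_opp Tpair_pow ?oppr0 // => X'' Y''.
exact: nijenhuis_Tpair.
Qed.

Lemma TpairB A B B' x X Y : derivable_mx B x -> derivable_mx B' x ->
  Tpair x A (fun y => B y - B' y) X Y = Tpair x A B X Y - Tpair x A B' X Y.
Proof.
move=> dB dB'; have DB v : Dmx (fun y => B y - B' y) x v = Dmx B x v - Dmx B' x v.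
  apply/matrixP => i j; rewrite [RHS]mxE [X in _ = _ + X]mxE !DmxE.
  rewrite (_ : (fun y => _) = fun y => B y i j + - B' y i j); last first.
    by apply/funext => y; rewrite !mxE.
  have dN : derivable_at (fun y => - B' y i j) x by move=> k; apply: derivableN;
    exact: dB'.
  by rewrite (DfunD v (dB i j) dN) (DfunN v (dB' i j)).
have DA : Dmx A x ((B x - B' x) *m Y) = Dmx A x (B x *m Y) - Dmx A x (B' x *m Y).
  by rewrite mulmxBl DmxD_dir -scaleN1r DmxZ_dir scaleN1r.
rewrite /Tpair !DB DA !(mulmxBl, mulmxBr) opprB.
by apply/matrixP => i j; rewrite !mxE; ring.
Qed.

Lemma Tpair_scalar A a x X Y : derivable_at a x ->
  Tpair x A (fun y => (a y)%:M) X Y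
    = ((Dfun a x (A x *m X))%:M - A x *m (Dfun a x X)%:M) *m Y.
Proof.
move=> da; rewrite (_ : (fun y => _) = fun y => a y *: 1%:M); last first.
  by apply/funext => y; rewrite scalemx1.
rewrite (TpairZ _ _ _ da (@derivable_mx_cst _ _ x _ _ _)) (_ : Tpair x A _ X Y = 0).
  by rewrite scaler0 add0r mulmx1 scalemx1 mul_mx_scalar.
by rewrite /Tpair !Dmx_cst !mul0mx mulmx0 mul0mx subr0 !mul1mx sub0r addNr.
Qed.

End Symmetries.

(** * The Nijenhuis operator in the frame of a regular conservation law *)

Section NijenhuisFrame.
Context {R : realType} {n : nat}.
Variable U : set 'rV[R]_n.+1.
Hypothesis U_open : open U.
Variables (L : 'rV[R]_n.+1 -> 'M[R]_n.+1) (df : 'rV[R]_n.+1 -> 'rV[R]_n.+1).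
Hypothesis NL : nijenhuis U L.
Hypothesis sdf : smooth_mx U df.
Hypothesis coframe : forall x, U x -> power_coframe L x (df x) \in unitmx.
Implicit Types (x y : 'rV[R]_n.+1) (X Y : 'cV[R]_n.+1).

Let sL : smooth_mx U L.
Proof. by case: NL. Qed.

Local Notation lamf Q := (fun x => lam L x (df x) (Q x)).

Lemma smooth_lam (Q : 'rV[R]_n.+1 -> 'M[R]_n.+1) :
  smooth_mx U Q -> smooth U (lamf Q).
Proof.
move=> sQ; have sE : smooth_mx U (fun x => power_coframe L x (df x)).
  move=> k j; apply: (@smooth_congr _ _ _ U_open (fun x => (df x *m L x ^+ k) 0 j)).
    by move=> x _; rewrite [RHS]mxE.
  by apply: smooth_mxM => //; exact: smooth_mxX.
apply: smooth_mxM => //; first exact: smooth_mxM.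
apply: smooth_mxM => //; first exact: smooth_invmx.
exact: smooth_mx_cst.
Qed.

(** By Cayley-Hamilton the sigmas are the coefficients of [L^(n+1)] in the powers of [L]. This gives
    their smoothness in step with that of [A_op]: [A_op L k] yields sigma [k.+1], which yields
    [A_op L k.+1]. *)
Lemma sigma_lam k x : U x -> (k <= n)%N ->
  sigma k.+1 (L x) = lam L x (df x) (L x ^+ n.+1 *m A_op L k x).
Proof.
move=> Ux kn; pose k' := Ordinal (kn : (k < n.+1)%N).
rewrite Cayley_Hamilton_sigma mulmx_suml lam_sum (bigD1 k') //= big1.
  by rewrite addr0 -scalemxAl lamZ (lam_dual_A (coframe Ux) k') // eqxx mulr1.
move=> j; rewrite -val_eqE /= => jk.
by rewrite -scalemxAl lamZ (lam_dual_A (coframe Ux) j) // eq_sym (negbTE jk) mulr0.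
Qed.

Lemma smooth_A k : (k <= n)%N -> smooth_mx U (A_op L k).
Proof.
elim: k => [_|k IH kn]; first exact: smooth_mx_cst.
have sA := IH (ltnW kn).
apply: (@smooth_mx_congr _ _ _ U_open _ _
  (fun x => L x *m A_op L k x - lam L x (df x) (L x ^+ n.+1 *m A_op L k x) *: 1%:M)).
  by move=> x Ux; rewrite -sigma_lam ?(ltnW kn) // scalemx1.
apply: smooth_mxD => //; first exact: smooth_mxM.
apply: smooth_mxN => //; apply: smooth_mxZ => //; last exact: smooth_mx_cst.
by apply: smooth_lam; apply: smooth_mxM => //; exact: smooth_mxX.
Qed.

Lemma smooth_sigma k : (k <= n)%N -> smooth U (fun x => sigma k.+1 (L x)).
Proof.
move=> kn; apply: (@smooth_congr _ _ _ U_open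
  (fun x => lam L x (df x) (L x ^+ n.+1 *m A_op L k x))).
  by move=> x Ux; rewrite sigma_lam.
apply: smooth_lam; apply: smooth_mxM => //; [exact: smooth_mxX|exact: smooth_A].
Qed.

Lemma mulmx_col_inj (A B : 'M[R]_n.+1) : (forall Y, A *m Y = B *m Y) -> A = B.
Proof.
move=> AB; apply/matrixP => i j; have := AB (delta_mx j 0).
by rewrite -!colE => /matrixP/(_ i 0); rewrite !mxE.
Qed.

Section Coefficients.
Variables (P Q : 'I_n.+1 -> 'rV[R]_n.+1 -> 'M[R]_n.+1)
  (N : 'rV[R]_n.+1 -> 'M[R]_n.+1) (c : 'I_n.+1 -> 'rV[R]_n.+1 -> R) (x : 'rV[R]_n.+1).
Hypothesis Ux : U x.
Hypothesis PQ : dual_pair L x (df x) (P^~ x) (Q^~ x).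
Hypothesis sc : forall k, smooth U (c k).
Hypothesis sP : forall k, smooth_mx U (P k).
Hypothesis NE : forall y, U y -> N y = \sum_k c k y *: P k y.
Hypothesis P0 : forall k X Y, Tpair x L (P k) X Y = 0.

Lemma coef_Tpair X Y :
  Tpair x L N X Y = defect (L x) (form_comb (diffs c x) (P^~ x)) X *m Y.
Proof.
rewrite (Tpair_comb U_open L X Y sc sP Ux NE) big1 ?add0r // => k _.
by rewrite P0 scaler0.
Qed.

Lemma coef_differential : (forall X Y, Tpair x L N X Y = 0) ->
  forall k, differential (c k) x =
    (\sum_i lam L x (df x) (P i x) *: differential (c i) x) *m Q k x.
Proof.
move=> N0; apply: (dual_forms (coframe Ux) PQ) => X.
apply/eqP; rewrite -subr_eq0; apply/eqP.
by apply: mulmx_col_inj => Y; rewrite -coef_Tpair N0 mul0mx.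
Qed.

Lemma coef_differential_conv theta :
  (forall k, differential (c k) x = theta *m Q k x) ->
  forall X Y, Tpair x L N X Y = 0.
Proof.
move=> cE X Y; rewrite coef_Tpair /defect.
by rewrite (dual_forms_conv (coframe Ux) PQ cE) subrr mul0mx.
Qed.

End Coefficients.

Definition tau x X : 'M[R]_n.+1 := (- Dfun (fun y => sigma 1 (L y)) x X)%:M.

Lemma pow_Tpair k x X Y : U x -> Tpair x L (fun y => L y ^+ k) X Y = 0.
Proof.
move=> Ux; have := Tpair_powers U_open 1 k X Y NL Ux.
by rewrite (_ : (fun y => L y ^+ 1) = L).
Qed.

(** The sigmas are the coefficients of [L^(n+1)], whose bracket with [L] vanishes; hence their
    differentials are one form times [A_op L k], and [k = 0] identifies that form. *)
Lemma differential_sigma x (k : 'I_n.+1) : U x ->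
  differential (fun y => sigma k.+1 (L y)) x
    = differential (fun y => sigma 1 (L y)) x *m A_op L k x.
Proof.
move=> Ux.
have dE := @coef_differential (fun j y => L y ^+ (n - j)) (fun j => A_op L j)
  (fun y => L y ^+ n.+1) (fun j y => sigma j.+1 (L y)) x Ux
  (dual_pair_A (coframe Ux)) (fun j => smooth_sigma (ltn_ord j : (j <= n)%N))
  (fun j => smooth_mxX U_open (n - j) sL) (fun y _ => Cayley_Hamilton_sigma L y)
  (fun j X Y => pow_Tpair (n - j) X Y Ux) (fun X Y => pow_Tpair n.+1 X Y Ux).
by rewrite (dE k); congr (_ *m _); rewrite (dE ord0) mulmx1.
Qed.

Lemma tau_linear x : linear (tau x).
Proof.
move=> a X Y; rewrite /tau DfunD_dir DfunZ_dir.
by rewrite -[RHS]/(a *: _%:M + _%:M) scale_scalar_mx -raddfD /= mulrN opprD.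
Qed.

(** As [<L, L> = 0], the product [L A_k] contributes only [L <L, A_k>], and the differential of the
    subtracted scalar is that of sigma 1 composed with [A_k]. Hence the same [tau] serves for all
    [k]. *)
Lemma A_Tpair k x X Y : U x -> (k <= n)%N ->
  Tpair x L (A_op L k) X Y = defect (A_op L k x) (tau x) X *m Y.
Proof.
move=> Ux; elim: k X Y => [|k IH] X Y kn.
  rewrite /defect /= !mul1mx subrr mul0mx.
  by rewrite /Tpair !Dmx_cst !mul0mx mulmx0 mul0mx subr0 !mul1mx sub0r addNr.
have sA := smooth_A (ltnW kn).
have dL : derivable_mx L x by exact: smooth_derivable_mx Ux.
have dA : derivable_mx (A_op L k) x by exact: smooth_derivable_mx Ux.
have ds : derivable_at (fun y => sigma k.+1 (L y)) x.
  by apply: smooth_derivable Ux; exact: smooth_sigma (ltnW kn).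
rewrite (_ : A_op L k.+1 = fun y => L y *m A_op L k y - (sigma k.+1 (L y))%:M) //.
rewrite TpairB; first last.
- exact: derivable_mx_scalar.
- exact: derivable_mxM.
rewrite TpairM // (nijenhuis_Tpair _ _ NL Ux) add0r (IH _ _ (ltnW kn)) (Tpair_scalar
  _ _ _ ds).
have DE v : Dfun (fun y => sigma k.+1 (L y)) x v
    = Dfun (fun y => sigma 1 (L y)) x (A_op L k x *m v).
  by rewrite /Dfun (differential_sigma (Ordinal (ltnW kn : (k < n.+1)%N)) Ux) mulmxA.
rewrite !DE mulmxA -mulmxBl; congr (_ *m Y).
set f := Dfun (fun y => sigma 1 (L y)) x; set s := sigma k.+1 (L x).
have fB : f ((L x *m A_op L k x - s%:M) *m X)
    = f (A_op L k x *m (L x *m X)) - s * f X.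
  rewrite /f mulmxBl mul_scalar_mx DfunD_dir -scaleNr DfunZ_dir mulNr.
  by rewrite mulmxA -(central_A L x k).
have tauE v : tau x v = (- f v) *: 1%:M by rewrite scalemx1.
rewrite -[RHS]/(defect (L x *m A_op L k x - s%:M) (tau x) X).
rewrite /defect !tauE fB !mul_mx_scalar -!scalemxAr !mulmx1 mulmxBr -!scalemxAr mulmx1.
move: (f _) (f _) (f _) => d0 d1 d2; rewrite -(scalemx1 _ d0) -(scalemx1 _ s).
by apply/matrixP => i j; rewrite !mxE; ring.
Qed.

End NijenhuisFrame.

(** * Killing tensors attached to a basis of symmetries *)

Section SymBasis.
Context {R : realType} {n : nat}.
Variable U : set 'rV[R]_n.+1.
Hypothesis U_open : open U.
Variables (L : 'rV[R]_n.+1 -> 'M[R]_n.+1) (df : 'rV[R]_n.+1 -> 'rV[R]_n.+1).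
Hypothesis NL : nijenhuis U L.
Hypothesis sdf : smooth_mx U df.
Hypothesis coframe : forall x, U x -> power_coframe L x (df x) \in unitmx.
Variables (M : 'I_n.+1 -> 'rV[R]_n.+1 -> 'M[R]_n.+1) (C : 'rV[R]_n.+1 -> 'M[R]_n.+1).
Hypothesis symM : forall i, Sym U L (M i).
Hypothesis C_unit : forall x, U x -> C x \in unitmx.
Hypothesis C_def : forall i x, U x ->
  M i x = \sum_(j < n.+1) C x i j *: L x ^+ (n - j).
Implicit Types (x y : 'rV[R]_n.+1) (X Y : 'cV[R]_n.+1).

Let sL : smooth_mx U L.
Proof. by case: NL. Qed.

Local Notation Rop i := (R_op L C i).
Local Notation central x Q := (Q *m L x = L x *m Q).

Let sM i : smooth_mx U (M i).
Proof. by case: (symM i). Qed.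

Lemma Sym_central N x : Sym U L N -> U x -> central x (N x).
Proof. by case=> _ _ LN _ Ux; rewrite LN. Qed.

Lemma R_central i x : central x (Rop i x).
Proof. by apply: central_lincomb => j; exact: central_A. Qed.

(** The powers and the [A_op] are dual; [M] arises from the powers by [C], and [R] from the [A_op]
    by the transposed inverse of [C]. *)
Lemma dual_M_R x : U x -> dual_pair L x (df x) (M^~ x) (fun i => Rop i x).
Proof.
move=> Ux; split=> [i|i|i j]; [exact: Sym_central|exact: R_central|].
have -> : (i == j)%:R = (C x *m invmx (C x)) i j by rewrite mulmxV ?C_unit // mxE.
rewrite C_def // mulmx_suml lam_sum mxE; apply: eq_bigr => k _.
rewrite -scalemxAl lamZ; congr (_ * _); rewrite /R_op mulmx_sumr lam_sum.
rewrite (bigD1 k) //= big1.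
  by rewrite addr0 -scalemxAr lamZ (lam_pow_A (coframe Ux)) eqxx mulr1.
move=> l /negbTE lk; rewrite -scalemxAr lamZ (lam_pow_A (coframe Ux)).
by rewrite eq_sym lk mulr0.
Qed.

(** [C] is given only through a pointwise expansion; this formula is the source of its
    smoothness. *)
Lemma C_lam i (j : 'I_n.+1) x : U x -> C x i j = lam L x (df x) (M i x *m A_op L j x).
Proof.
move=> Ux; rewrite C_def // mulmx_suml lam_sum (bigD1 j) //= big1.
  by rewrite addr0 -scalemxAl lamZ (lam_pow_A (coframe Ux)) eqxx mulr1.
by move=> k /negbTE kj; rewrite -scalemxAl lamZ (lam_pow_A (coframe Ux)) kj mulr0.
Qed.

Let sA (j : 'I_n.+1) : smooth_mx U (A_op L j).
Proof. exact: smooth_A (ltn_ord j : (j <= n)%N). Qed.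

Lemma smooth_C : smooth_mx U C.
Proof.
move=> i j; apply: (@smooth_congr _ _ _ U_open (fun x => lam L x (df x) (M i x *m
  A_op L j x))).
  by move=> x Ux; rewrite -C_lam.
by apply: smooth_lam => //; apply: smooth_mxM.
Qed.

Lemma smooth_R i : smooth_mx U (Rop i).
Proof.
apply: smooth_mx_sum => // j; apply: smooth_mxZ => //.
exact: (smooth_invmx U_open C_unit smooth_C).
Qed.

Lemma A_R_expand (j : 'I_n.+1) x : U x -> A_op L j x = \sum_k C x k j *: Rop k x.
Proof.
move=> Ux; rewrite /R_op; under eq_bigr do rewrite scaler_sumr.
rewrite exchange_big /= (bigD1 j) //= [X in _ + X]big1.
  rewrite addr0; under eq_bigr do rewrite scalerA mulrC.
  rewrite -scaler_suml (_ : \sum_(i < n.+1) _ = (invmx (C x) *m C x) j j).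
    by rewrite mulVmx ?C_unit // mxE eqxx scale1r.
  by rewrite mxE.
move=> l /negbTE lj; under eq_bigr do rewrite scalerA mulrC.
rewrite -scaler_suml (_ : \sum_(i < n.+1) _ = (invmx (C x) *m C x) l j).
  by rewrite mulVmx ?C_unit // mxE lj scale0r.
by rewrite mxE.
Qed.

Definition dC0 x k : 'rV[R]_n.+1 := differential (fun y => C y k ord0) x.

Lemma differential_C x k (j : 'I_n.+1) : U x ->
  differential (fun y => C y k j) x = dC0 x k *m A_op L j x.
Proof.
move=> Ux.
have dE := @coef_differential _ _ U U_open L df coframe
  (fun j y => L y ^+ (n - j)) (fun j => A_op L j) (M k) (fun j y => C y k j) x Ux
  (dual_pair_A (coframe Ux)) (fun j => smooth_C k j)
  (fun j => smooth_mxX U_open (n - j) sL) (fun y Uy => C_def k Uy)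
  (fun j X Y => pow_Tpair U_open NL (n - j) X Y Ux)
  (fun X Y => Sym_Tpair X Y (symM k) Ux).
by rewrite (dE j); congr (_ *m _); rewrite /dC0 (dE ord0) mulmx1.
Qed.

Definition C_form x : 'cV[R]_n.+1 -> 'M[R]_n.+1 := form_comb (dC0 x) (fun k => Rop k x).

(** The correction to [tau] stems from the non-constant coefficients in [A_j = sum_k C_kj R_k].
    Since [dC_kj = dC_k0 A_j], their differentials assemble to [C_form] at [A_j X]. *)
Definition R_potential x X : 'M[R]_n.+1 := tau L x X - defect (L x) (C_form x) X.

Lemma R_potential_linear x : linear (R_potential x).
Proof.
apply: linear_fun_sub; first exact: tau_linear.
by apply: defect_linear; exact: form_comb_linear.
Qed.

(** Compute [<L, A_j>] through the expansion of [A_j] in the [R_k], move the terms in [dC] to the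
    other side and invert [C]. The correction enters only where the operator acts on the argument,
    so this is not yet a defect. *)
Lemma R_Tpair i x X Y : U x ->
  Tpair x L (Rop i) X Y = (R_potential x (Rop i x *m X) - Rop i x *m tau L x X) *m Y.
Proof.
move=> Ux.
have EW (j : 'I_n.+1) Z : form_comb (diffs (fun k y => C y k j) x) (fun k => Rop k x) Z
    = C_form x (A_op L j x *m Z).
  by apply: eq_bigr => k _; rewrite /diffs differential_C // mulmxA.
have EA (j : 'I_n.+1) : \sum_k C x k j *: Tpair x L (Rop k) X Y
    = (R_potential x (A_op L j x *m X) - A_op L j x *m tau L x X) *m Y.
  have jn : (j <= n)%N by rewrite -ltnS.
  have := A_Tpair U_open NL sdf coframe X Y Ux jn.
  rewrite (Tpair_comb U_open L X Y (fun k => smooth_C k j) smooth_R Ux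
    (fun y Uy => A_R_expand j Uy)) => E.
  rewrite -[LHS](addrK (defect (L x) (form_comb (diffs (fun k y => C y k j) x) (fun k
    => Rop k x)) X *m Y)).
  rewrite E -mulmxBl; congr (_ *m Y).
  by rewrite /R_potential /defect !EW !mulmxA central_A addrAC.
have -> : Tpair x L (Rop i) X Y
    = \sum_(j < n.+1) invmx (C x) j i *: \sum_k C x k j *: Tpair x L (Rop k) X Y.
  under eq_bigr do rewrite scaler_sumr.
  rewrite exchange_big /= (bigD1 i) //= [X in _ + X]big1.
    rewrite addr0; under eq_bigr do rewrite scalerA mulrC.
    rewrite -scaler_suml (_ : \sum_(j < n.+1) _ = (C x *m invmx (C x)) i i).
      by rewrite mulmxV ?C_unit // mxE eqxx scale1r.
    by rewrite mxE.
  move=> l /negbTE li; under eq_bigr do rewrite scalerA mulrC.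
  rewrite -scaler_suml (_ : \sum_(j < n.+1) _ = (C x *m invmx (C x)) l i).
    by rewrite mulmxV ?C_unit // mxE li scale0r.
  by rewrite mxE.
under eq_bigr do rewrite EA scalemxAl.
rewrite -mulmx_suml; congr (_ *m Y); under eq_bigr do rewrite scalerBr.
rewrite sumrB /R_op !mulmx_suml; under [in RHS]eq_bigr do rewrite -scalemxAl.
rewrite (linear_fun_sum (@R_potential_linear x)); congr (_ - _).
by apply: eq_bigr => j _; rewrite scalemxAl.
Qed.

Lemma coef_lam (N : 'rV[R]_n.+1 -> 'M[R]_n.+1) (c : 'I_n.+1 -> R) x k : U x ->
  N x = \sum_i c i *: M i x -> c k = lam L x (df x) (N x *m Rop k x).
Proof.
move=> Ux NE; have [_ _ MR1] := dual_M_R Ux.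
rewrite NE mulmx_suml lam_sum (bigD1 k) //= big1.
  by rewrite addr0 -scalemxAl lamZ MR1 eqxx mulr1.
by move=> i /negbTE ik; rewrite -scalemxAl lamZ MR1 ik mulr0.
Qed.

Lemma smooth_coef (N : 'rV[R]_n.+1 -> 'M[R]_n.+1) k : smooth_mx U N ->
  smooth U (fun x => lam L x (df x) (N x *m Rop k x)).
Proof.
by move=> sN; apply: smooth_lam => //; apply: smooth_mxM => //; exact: smooth_R.
Qed.

Lemma Sym_expand N x : Sym U L N -> U x ->
  N x = \sum_k lam L x (df x) (N x *m Rop k x) *: M k x.
Proof.
move=> symN Ux; apply: (dual_expand (coframe Ux) (dual_M_R Ux)).
exact: Sym_central symN Ux.
Qed.

(** * Brackets, conservation laws and symmetries of the Killing tensors *)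

Section Killing.
Hypothesis R0_unit : forall x, U x -> Rop ord0 x \in unitmx.
Variable K : 'I_n.+1 -> 'rV[R]_n.+1 -> 'M[R]_n.+1.
Hypothesis KE : forall i x, U x -> K i x = Rop i x *m invmx (Rop ord0 x).

Lemma K_central i x : U x -> central x (K i x).
Proof.
move=> Ux; rewrite KE //; apply: centralM; first exact: R_central.
by apply: centralV; [exact: R0_unit|exact: R_central].
Qed.

Lemma smooth_K i : smooth_mx U (K i).
Proof.
apply: (@smooth_mx_congr _ _ _ U_open _ _ (fun x => Rop i x *m invmx (Rop ord0 x))).
  by move=> x Ux; rewrite KE.
apply: smooth_mxM => //; first exact: smooth_R.
by apply: smooth_invmx => //; exact: smooth_R.
Qed.

Lemma K_R0 i x : U x -> Rop i x = K i x *m Rop ord0 x.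
Proof. by move=> Ux; rewrite KE // mulmxKV // R0_unit. Qed.

Lemma K0_id x : U x -> K ord0 x = 1%:M.
Proof. by move=> Ux; rewrite KE // mulmxV // R0_unit. Qed.

Definition K_potential x X : 'M[R]_n.+1 := R_potential x (Rop ord0 x *m X) *m invmx
  (Rop ord0 x).

Lemma K_potential_linear x : linear (K_potential x).
Proof.
move=> a X Y; rewrite /K_potential mulmxDr -scalemxAr R_potential_linear mulmxDl.
by rewrite -scalemxAl.
Qed.

(** Apply the Leibniz rule to [R_i = K_i R_0]. Subtracting [K_i <L, R_0>] cancels the [tau] terms,
    and what is left is a genuine defect of a form independent of [i]. *)
Lemma K_Tpair i x X Y : U x -> Tpair x L (K i) X Y = defect (K i x) (K_potential x) X
  *m Y.
Proof.
move=> Ux; have uR := R0_unit Ux.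
have cK := K_central i Ux.
have sR0 := @smooth_R ord0.
have dK : derivable_mx (K i) x by apply: smooth_derivable_mx Ux; exact: smooth_K.
have dR : derivable_mx (Rop ord0) x by apply: smooth_derivable_mx Ux; exact: sR0.
pose Y' := invmx (Rop ord0 x) *m Y.
have RY : Rop ord0 x *m Y' = Y by rewrite /Y' mulmxA mulmxV // mul1mx.
have := @R_Tpair i x X Y' Ux.
rewrite (@Tpair_congr _ _ x U L L (Rop i) (fun y => K i y *m Rop ord0 y) X Y' U_open
  Ux) //;
  last by move=> y Uy; exact: K_R0.
rewrite (TpairM _ _ dK dR (esym cK)) RY (R_Tpair _ _ _ Ux) => E.
rewrite -[LHS](addrK (K i x *m ((R_potential x (Rop ord0 x *m X) - Rop ord0 x *m tau
  L x X) *m Y'))) E.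
rewrite [K i x *m (_ *m Y')]mulmxA -mulmxBl /Y' mulmxA; congr (_ *m Y).
rewrite /defect /K_potential [K i x *m (_ *m invmx _)]mulmxA -mulmxBl; congr (_ *m
  invmx _).
rewrite (K_R0 i Ux) mulmxBr !mulmxA opprB addrA subrK.
by rewrite (central_comm (coframe Ux) cK (R_central ord0 x)).
Qed.

Definition kcoef i (j : 'I_n.+1) x : R := lam L x (df x) (K i x *m A_op L j x).

Lemma smooth_kcoef i j : smooth U (kcoef i j).
Proof. by apply: smooth_lam => //; apply: smooth_mxM => //; exact: smooth_K. Qed.

Lemma power_expand (B : 'rV[R]_n.+1 -> 'M[R]_n.+1) x : U x -> central x (B x) ->
  B x = \sum_(j < n.+1) lam L x (df x) (B x *m A_op L j x) *: L x ^+ (n - j).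
Proof. by move=> Ux cB; exact: (dual_expand (coframe Ux) (dual_pair_A (coframe Ux))
  cB). Qed.

(** The bracket is a difference of two defects, applied in general to different vectors. On the
    diagonal the vectors coincide, and [defect_exchange] identifies the defects. *)
Lemma K_symmetric_Tpair i j x X : U x -> Tpair x (K i) (K j) X X = 0.
Proof.
move=> Ux.
have KX k y (Uy : U y) := power_expand Uy (K_central k Uy).
have T := @Tpair_comb2 _ _ U U_open (kcoef i) (kcoef j) (fun l y => L y ^+ (n - l))
  (K i) (K j) x X X (smooth_kcoef i) (smooth_kcoef j)
  (fun l => smooth_mxX U_open (n - l) sL) Ux
  (fun k l X Y => Tpair_powers U_open (n - k) (n - l) X Y NL Ux) (KX i) (KX j).
rewrite T -mulmxBl.
(* Both sides represent [<L, K_k>]: the left one through the coefficients in the powers of [L], the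
   right one by [K_Tpair]. *)
have D k Y : defect (L x) (form_comb (diffs (kcoef k) x) (fun l => L x ^+ (n - l))) Y
    = defect (K k x) (K_potential x) Y.
  apply: mulmx_col_inj => Z; rewrite -K_Tpair //.
  rewrite -(@coef_Tpair _ _ U U_open L (fun l y => L y ^+ (n - l)) (K k) (kcoef k) x Ux
    (smooth_kcoef k) (fun l => smooth_mxX U_open (n - l) sL) (KX k)) //.
  by move=> l X' Y'; exact: (pow_Tpair U_open NL (n - l) X' Y' Ux).
rewrite (defect_exchange (coframe Ux) X (KX i x Ux) (K_central j Ux)
  (form_comb_linear _ _) (form_comb_linear _ _) (@K_potential_linear x) (D i) (D j)).
by rewrite subrr mul0mx.
Qed.

Lemma K_comm i j x : U x -> K i x *m K j x = K j x *m K i x.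
Proof. by move=> Ux; apply: (central_comm (coframe Ux)); exact: K_central. Qed.

Lemma K_symmetries i j : symmetries U (K i) (K j).
Proof.
apply: Tpair_symmetries; try exact: smooth_K.
  by move=> x Ux; exact: K_comm.
by move=> x X Ux; exact: K_symmetric_Tpair.
Qed.

Lemma Sym_coef_differential N c x : Sym U L N ->
  (forall y, U y -> N y = \sum_i c i y *: M i y) -> (forall i, smooth U (c i)) ->
  U x -> exists theta : 'rV[R]_n.+1, forall k, differential (c k) x = theta *m Rop k x.
Proof.
move=> symN NE sc Ux.
exists (\sum_i lam L x (df x) (M i x) *: differential (c i) x) => k.
exact: (@coef_differential _ _ U U_open L df coframe M (fun k => Rop k) N c x Ux
  (dual_M_R Ux) sc sM NE (fun k X Y => Sym_Tpair X Y (symM k) Ux)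
  (fun X Y => Sym_Tpair X Y symN Ux)).
Qed.

Lemma Sym_coef_smooth N c : Sym U L N ->
  (forall y, U y -> N y = \sum_i c i y *: M i y) -> forall i, smooth U (c i).
Proof.
move=> symN NE i; have [_ sN _ _] := symN.
apply: (@smooth_congr _ _ _ U_open (fun x => lam L x (df x) (N x *m Rop i x))).
  by move=> x Ux; rewrite -(coef_lam (c := c^~ x) i Ux (NE x Ux)).
exact: smooth_coef.
Qed.

Lemma Sym_coef_K N c : Sym U L N ->
  (forall y, U y -> N y = \sum_i c i y *: M i y) ->
  forall i x, U x -> dual_app (K i) (differential (c ord0)) x = differential (c i) x.
Proof.
move=> symN NE i x Ux; have sc := Sym_coef_smooth symN NE.
have [theta dc] := Sym_coef_differential symN NE sc Ux.
rewrite /dual_app !dc -mulmxA; congr (_ *m _).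
by rewrite (central_comm (coframe Ux) (R_central ord0 x) (K_central i Ux)) -K_R0.
Qed.

Lemma Sym_coef_conservation N c : Sym U L N ->
  (forall y, U y -> N y = \sum_i c i y *: M i y) ->
  forall i, conservation_law U (K i) (differential (c ord0)).
Proof.
move=> symN NE i; have sc := Sym_coef_smooth symN NE.
split; first exact: closed_differential.
apply: (@closed_form_congr _ _ _ U_open (differential (c i))).
  by move=> x Ux; rewrite (Sym_coef_K symN NE).
exact: closed_differential.
Qed.

(** Potentials [g i] of the closed forms [alpha K_i] satisfy [dg_i = (alpha R_0^-1) R_i], which is
    the criterion for [sum_i g_i M_i] to be a symmetry. *)
Lemma conservation_Sym alpha x0 :
  (forall i, conservation_law U (K i) alpha) -> U x0 ->
  exists V : set 'rV[R]_n.+1, [/\ open V, V x0, V `<=` U &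
    exists N c, [/\ Sym V L N, forall x, V x -> N x = \sum_i c i x *: M i x &
      forall x, V x -> alpha x = differential (c ord0) x]].
Proof.
move=> cl Ux0.
have [V [Vo Vx0 VU [g gP]]] := @local_potentials _ _ U U_open _
  (fun i => dual_app (K i) alpha) x0 (fun i => (cl i).2) Ux0.
have sg i : smooth V (g i) by have [] := gP i.
have sMV i : smooth_mx V (M i) by exact: smooth_mx_subset VU (sM i).
exists V; split=> //; exists (fun x => \sum_i g i x *: M i x), g; split=> //; last
  first.
  by move=> x Vx; have [_ ->] := gP ord0; rewrite // /dual_app K0_id ?mulmx1 //;
    exact: VU.
apply: Tpair_Sym.
- exact: smooth_mx_subset VU sL.
- by apply: smooth_mx_sum => // i; exact: smooth_mxZ.
- move=> x /VU Ux; apply: esym; apply: central_lincomb => i.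
  exact: Sym_central (symM i) Ux.
move=> x X Y Vx; have Ux := VU x Vx.
apply: (@coef_differential_conv _ _ V Vo L df (fun y Vy => coframe (VU y Vy)) M
  (fun k => Rop k) _ g x Vx (dual_M_R Ux) sg sMV (fun y Vy => erefl)
  (fun k X Y => Sym_Tpair X Y (symM k) Ux)
  (alpha x *m invmx (Rop ord0 x))) => k.
have [_ ->] := gP k; rewrite // /dual_app KE // -mulmxA; congr (_ *m _).
apply: (central_comm (coframe Ux)); first exact: R_central.
by apply: centralV; [exact: R0_unit|exact: R_central].
Qed.

Definition Kform (r : 'I_n.+1 -> 'rV[R]_n.+1 -> R) x :=
  form_comb (diffs r x) (fun k => K k x).

Lemma Kform_R r x X : U x ->
  form_comb (diffs r x) (fun k => Rop k x) X = Kform r x X *m Rop ord0 x.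
Proof.
move=> Ux; rewrite /Kform /form_comb mulmx_suml; apply: eq_bigr => k _.
by rewrite -scalemxAl -K_R0.
Qed.

Lemma Kform_central r x X : U x -> central x (Kform r x X).
Proof. by move=> Ux; apply: form_comb_central => k; exact: K_central. Qed.

Lemma K_comb_Tpair r S i x X : (forall k, smooth U (r k)) ->
  (forall y, U y -> S y = \sum_k r k y *: K k y) -> U x ->
  Tpair x (K i) S X X = defect (K i x) (Kform r x) X *m X.
Proof.
move=> sr SE Ux; rewrite (Tpair_comb U_open (K i) X X sr smooth_K Ux SE).
by rewrite big1 ?add0r // => k _; rewrite K_symmetric_Tpair // scaler0.
Qed.

(** By duality [dr_k = dr M_k] makes [sum_k dr_k R_k] equivariant under [L]. Cancelling [R_0] gives
    the same for [Kform], which is then equivariant under every [K_i]. *)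
Lemma conservation_symmetries dr r i :
  (forall k, smooth U (r k)) ->
  (forall k x, U x -> differential (r k) x = dual_app (M k) dr x) ->
  symmetries U (K i) (fun x => \sum_k r k x *: K k x).
Proof.
move=> sr drE; apply: Tpair_symmetries.
- exact: smooth_K.
- by apply: smooth_mx_sum => // k; apply: smooth_mxZ => //; exact: smooth_K.
- move=> x Ux; apply: (central_comm (coframe Ux)); first exact: K_central.
  by apply: central_lincomb => k; exact: K_central.
move=> x X Ux; rewrite (K_comb_Tpair i X sr (fun y _ => erefl) Ux).
rewrite (_ : defect _ _ X = 0) ?mul0mx //.
apply: (defect_equivariant (coframe Ux)); first exact: K_central.
  exact: form_comb_linear.
move=> Y; have := dual_forms_conv (coframe Ux) (dual_pairC (coframe Ux) (dual_M_R Ux))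
  (a := diffs r x) (theta := dr x) (fun k => drE k x Ux) Y.
rewrite !Kform_R // mulmxA => /(can_inj (mulmxK (R0_unit Ux))) E.
by rewrite /defect E subrr.
Qed.

(** The basis dual to the [K k] is [R_0 M_k]. In particular [L] itself is a combination of the
    [K k], so what holds for all of them passes to [L]. *)
Lemma K_expand (B : 'M[R]_n.+1) x : U x -> central x B ->
  B = \sum_k lam L x (df x) (B *m Rop ord0 x *m M k x) *: K k x.
Proof.
move=> Ux cB; apply: (can_inj (mulmxK (R0_unit Ux))).
rewrite [LHS](dual_expand (coframe Ux) (dual_pairC (coframe Ux) (dual_M_R Ux))); last
  first.
  by apply: centralM => //; exact: R_central.
by rewrite mulmx_suml; apply: eq_bigr => k _; rewrite -scalemxAl -K_R0.
Qed.

(** * Common symmetries come from conservation laws *)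

Section CommonSymmetry.
Variable S : 'rV[R]_n.+1 -> 'M[R]_n.+1.
Hypothesis symS : forall i, symmetries U (K i) S.

Lemma S_central x : U x -> central x (S x).
Proof.
move=> Ux; rewrite [L x](K_expand Ux (erefl : central x (L x))).
rewrite mulmx_sumr mulmx_suml; apply: eq_bigr => k _.
by rewrite -scalemxAr -scalemxAl; have [_ _ -> //] := symS k.
Qed.

Definition scoef k x : R := lam L x (df x) (S x *m Rop ord0 x *m M k x).

Lemma smooth_scoef k : smooth U (scoef k).
Proof.
have [_ sS _ _] := symS k.
apply: smooth_lam => //; apply: smooth_mxM => //; apply: smooth_mxM => //.
exact: smooth_R.
Qed.

Lemma S_expand x : U x -> S x = \sum_k scoef k x *: K k x.
Proof. by move=> Ux; apply: K_expand => //; exact: S_central. Qed.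

Definition scoef_form x : 'rV[R]_n.+1 :=
  \sum_i lam L x (df x) (Rop i x) *: differential (scoef i) x.

Lemma differential_scoef k x : U x -> differential (scoef k) x = scoef_form x *m M k x.
Proof.
move=> Ux.
have lK : linear (Kform scoef x) by exact: form_comb_linear.
(* The symmetry condition only says that the defect at [Y] kills [Y]; polarization makes it
   vanish. *)
have D0 i X : defect (K i x) (Kform scoef x) X = 0.
  apply: (polarization (coframe Ux)).
  - exact: defect_linear.
  - move=> Y; apply: defect_central; first exact: K_central.
    by move=> Z; exact: Kform_central.
  move=> Y; rewrite -(K_comb_Tpair i Y smooth_scoef (fun y Uy => S_expand Uy) Ux).
  exact: symmetries_Tpair (symS i) Ux.
apply: (dual_forms (coframe Ux) (dual_pairC (coframe Ux) (dual_M_R Ux))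
  (a := diffs scoef x)) => X.
rewrite !Kform_R // mulmxA; congr (_ *m _).
apply/eqP; rewrite -subr_eq0; apply/eqP; rewrite -/(defect (L x) (Kform scoef x) X).
rewrite [L x](K_expand Ux (erefl : central x (L x))) defect_lincomb // big1 // => k' _.
by rewrite D0 scaler0.
Qed.

(** With [N = sum c_k M_k] the form is [sum c_k ds_k], where [s_k] stands for [scoef k], and its
    exterior derivative is the sum of the wedges of [dc_k] and [ds_k]. Since [dc_k = nu R_k] and
    [ds_k = theta M_k], this vanishes by [dual_symmetric]. *)
Lemma theta_Sym_closed N : Sym U L N -> closed_form U (dual_app N scoef_form).
Proof.
move=> symN; have [_ sN _ _] := symN.
pose c k x := lam L x (df x) (N x *m Rop k x).
have NE y (Uy : U y) : N y = \sum_k c k y *: M k y by exact: Sym_expand.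
have sc k : smooth U (c k) by exact: smooth_coef.
have sdr k j : smooth U (partial j (scoef k)) by exact/smooth_partial/smooth_scoef.
pose rho x : 'rV[R]_n.+1 := \row_j \sum_k c k x * partial j (scoef k) x.
have rhoE b : (fun y => rho y 0 b) = fun y => \sum_k c k y * partial b (scoef k) y.
  by apply/funext => y; rewrite mxE.
apply: (@closed_form_congr _ _ _ U_open rho).
  move=> x Ux; apply/rowP => j; rewrite /dual_app NE // mulmx_sumr summxE mxE.
  apply: eq_bigr => k _.
  by rewrite -scalemxAr -differential_scoef // !mxE.
split.
  by move=> i j; rewrite ord1 rhoE; apply: smooth_sum => // k; exact: smoothM.
move=> x Ux i j.
have P (a b : 'I_n.+1) : partial a (fun y => rho y 0 b) x
    = \sum_k c k x * partial a (partial b (scoef k)) x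
      + \sum_k partial a (c k) x * partial b (scoef k) x.
  rewrite rhoE.
  have dc k : derivable_at (c k) x by exact: smooth_derivable (sc k) Ux.
  have dr k : derivable_at (partial b (scoef k)) x by exact: smooth_derivable (sdr k
    b) Ux.
  rewrite partial_sum; last by move=> k; exact: derivableM_at (dc k) (dr k).
  rewrite -big_split; apply: eq_bigr => k _.
  exact: partialM (dc k) (dr k).
have E1 : \sum_k c k x * partial i (partial j (scoef k)) x
    = \sum_k c k x * partial j (partial i (scoef k)) x.
  apply: eq_bigr => k _.
  by rewrite (@Schwarz _ _ _ (scoef k) i j x U_open (smooth_scoef k 2) Ux).
have [nu dc] := Sym_coef_differential symN NE sc Ux.
have pc k l : partial l (c k) x = (nu *m Rop k x *m (delta_mx l 0 : 'cV_n.+1)) 0 0.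
  by rewrite -dc -colE !mxE.
have pr k l : partial l (scoef k) x = (scoef_form x *m M k x *m (delta_mx l 0 :
  'cV_n.+1)) 0 0.
  by rewrite -(differential_scoef k Ux) -colE !mxE.
have E2 a b : \sum_k partial a (c k) x * partial b (scoef k) x
    = \sum_k (nu *m Rop k x *m (delta_mx a 0 : 'cV_n.+1)) 0 0
        * (scoef_form x *m M k x *m (delta_mx b 0 : 'cV_n.+1)) 0 0.
  by apply: eq_bigr => k _; rewrite (pc k a) (pr k b).
have sym := dual_symmetric (coframe Ux) (dual_M_R Ux) nu (scoef_form x)
  (delta_mx i 0) (delta_mx j 0).
have E3 := etrans (E2 i j) (etrans sym (esym (E2 j i))).
exact: etrans (P i j) (etrans (congr2 +%R E1 E3) (esym (P j i))).
Qed.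

Lemma symmetry_conservation x0 : U x0 ->
  exists V : set 'rV[R]_n.+1, [/\ open V, V x0, V `<=` U &
    exists r0 r, [/\ smooth V r0, conservation_law V L (differential r0),
      forall k, smooth V (r k),
      forall k x, V x -> differential (r k) x = dual_app (M k) (differential r0) x &
      forall x, V x -> S x = \sum_k r k x *: K k x]].
Proof.
move=> Ux0.
(* Closedness for the symmetries [Id] and [L] says that the form has local potentials and that these
   give conservation laws of [L]. *)
have sym1 : Sym U L (fun=> 1%:M).
  apply: Tpair_Sym => //; first exact: smooth_mx_cst.
    by move=> x Ux; rewrite mulmx1 mul1mx.
  by move=> x X Y Ux; exact: (pow_Tpair U_open NL 0 X Y Ux).
have symL : Sym U L L.
  by apply: Tpair_Sym => // x X Y Ux; exact: nijenhuis_Tpair NL Ux.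
have cth : closed_form U scoef_form.
  apply: (@closed_form_congr _ _ _ U_open (dual_app (fun=> 1%:M) scoef_form)).
    by move=> x Ux; rewrite /dual_app mulmx1.
  exact: theta_Sym_closed.
have [V [Vo Vx0 VU [g gP]]] := @local_potentials _ _ U U_open unit (fun=> scoef_form) x0
  (fun=> cth) Ux0.
have [sg gE] := gP tt.
exists V; split=> //; exists (g tt), scoef; split=> //.
- split; first exact: closed_differential.
  apply: (@closed_form_congr _ _ _ Vo (dual_app L scoef_form)).
    by move=> x Vx; rewrite /dual_app gE.
  exact: closed_form_subset VU (theta_Sym_closed symL).
- by move=> k; exact: smooth_subset VU (smooth_scoef k).
- by move=> k x Vx; rewrite /dual_app gE // differential_scoef //; exact: VU.
- by move=> x /VU; exact: S_expand.
Qed.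

End CommonSymmetry.

End Killing.

(** The Nijenhuis torsion of [B] has the form [psi (X) Y - psi (Y) X] with values of [psi] commuting
    with [B], and the four Haantjes terms then cancel in pairs. *)
Lemma central_haantjes (B : 'rV[R]_n.+1 -> 'M[R]_n.+1) :
  smooth_mx U B -> (forall x, U x -> central x (B x)) -> haantjes U B.
Proof.
move=> sB cB; split=> // X Y sX sY x Ux.
pose b j y := lam L y (df y) (B y *m A_op L j y).
have sb (j : 'I_n.+1) : smooth U (b j).
  by apply: smooth_lam => //; exact: smooth_mxM.
have BE y (Uy : U y) := power_expand Uy (cB y Uy).
pose psi := defect (B x) (form_comb (diffs (fun j : 'I_n.+1 => b j) x) (fun j => L x
  ^+ (n - j))).
have cpsi V : central x (psi V).
  apply: defect_central; first exact: cB.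
  by move=> W; apply: form_comb_central => k; exact: central_pow.
have BV V : B x *m psi V = psi V *m B x.
  by apply: (central_comm (coframe Ux)); [exact: cB|].
have N (V W : 'rV[R]_n.+1 -> 'cV[R]_n.+1) : smooth_mx U V -> smooth_mx U W ->
    nijenhuis_torsion B V W x = psi (V x) *m W x - psi (W x) *m V x.
  move=> sV sW; rewrite nijenhuis_torsionE pair_bracketE //;
    try exact: smooth_derivable_mx Ux.
  exact: (@Tpair_comb2 _ _ U U_open (fun j : 'I_n.+1 => b j) (fun j : 'I_n.+1 => b j)
    (fun l y => L y ^+ (n - l))
    B B x (V x) (W x) sb sb (fun l => smooth_mxX U_open (n - l) sL) Ux
    (fun k l X Y => Tpair_powers U_open (n - k) (n - l) X Y NL Ux) BE BE).
have sBX : smooth_mx U (op_app B X) by exact: smooth_mxM.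
have sBY : smooth_mx U (op_app B Y) by exact: smooth_mxM.
rewrite /haantjes_torsion !N // /op_app.
have -> : B x ^+ 2 = B x *m B x by exact: expr2.
have psiB V W : psi V *m (B x *m W) = B x *m (psi V *m W) by rewrite !mulmxA BV.
rewrite -(mulmxA (B x) (B x)) !psiB !mulmxBr.
by apply/matrixP => i j; rewrite !mxE; ring.
Qed.

End SymBasis.

(** * From the hypotheses to the pointwise algebra *)

Section Assembly.
Context {R : realType} {n : nat}.
Variable U : set 'rV[R]_n.+1.
Implicit Types (x : 'rV[R]_n.+1) (L : 'rV[R]_n.+1 -> 'M[R]_n.+1).

Lemma pointwise_free_eq0 (V : vectType R) (T : 'I_n.+1 -> 'rV[R]_n.+1 -> V) x
    (w : 'I_n.+1 -> R) :
  pointwise_free U T -> U x -> \sum_i w i *: T i x = 0 -> forall i, w i = 0.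
Proof.
move=> free_T Ux w0; pose X := [tuple T i x | i < n.+1].
have /freeP : free X by exact: free_T Ux.
apply; rewrite -[RHS]w0; apply: eq_bigr => i _.
by rewrite -tnth_nth tnth_mktuple.
Qed.

Lemma du_coframeE L df (k : 'I_n.+1) x : du_coframe L df k x = df x *m L x ^+ k.
Proof.
rewrite /du_coframe; elim: (nat_of_ord k) => [|m IH]; first by rewrite expr0 mulmx1.
by rewrite iterS /dual_app IH exprSr -mulmxA.
Qed.

Lemma regular_coframe_unit L df x : regular_conservation_law U L df -> U x ->
  power_coframe L x (df x) \in unitmx.
Proof.
move=> [_ free_df] Ux; apply: free_rows_unit => w w0.
apply/rowP => i; rewrite [RHS]mxE.
apply: (pointwise_free_eq0 (w := fun i => w 0 i) free_df Ux).
apply: etrans w0; rewrite mulmx_sum_row; apply: eq_bigr => k _.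
by rewrite du_coframeE rowK.
Qed.

Variables (L : 'rV[R]_n.+1 -> 'M[R]_n.+1)
  (M : 'I_n.+1 -> 'rV[R]_n.+1 -> 'M[R]_n.+1) (C : 'rV[R]_n.+1 -> 'M[R]_n.+1).
Hypothesis M_basis : Sym_basis U L M.
Hypothesis C_def : forall i x, U x ->
  M i x = \sum_(j < n.+1) C x i j *: L x ^+ (n - j).

Lemma basis_matrix_unit x : U x -> C x \in unitmx.
Proof.
move=> Ux; apply: free_rows_unit => w w0; apply/rowP => i; rewrite [RHS]mxE.
apply: (pointwise_free_eq0 (w := fun i => w 0 i) M_basis.2 Ux).
under eq_bigr do rewrite C_def // scaler_sumr.
rewrite exchange_big big1 //= => j _; under eq_bigr do rewrite scalerA.
rewrite -scaler_suml (_ : \sum_i _ = (w *m C x) 0 j); last by rewrite mxE.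
by rewrite w0 mxE scale0r.
Qed.

Lemma killing_R df h g K : regular_conservation_law U L df ->
  killing_tensors U L M df h g K ->
  (forall x, U x -> R_op L C ord0 x \in unitmx) /\
  (forall i x, U x -> K i x = R_op L C i x *m invmx (R_op L C ord0 x)).
Proof.
move=> reg_df [hM [_ g_metric] h0 K_adj hi].
have coframe x (Ux : U x) := regular_coframe_unit reg_df Ux.
have MR x (Ux : U x) := dual_M_R coframe M_basis.1 basis_matrix_unit C_def Ux.
have hE x D : U x -> D *m L x = L x *m D ->
    \sum_i h i x (df x *m D) *: M i x = D *m D.
  move=> Ux cD; pose p := df x *m D *m invmx (power_coframe L x (df x)).
  have pE : df x *m D = \sum_k p 0 k *: (df x *m L x ^+ k).
    rewrite -[LHS](mulmxKV (coframe x Ux)) -/p mulmx_sum_row.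
    by apply: eq_bigr => k _; rewrite rowK.
  (* The momenta of [e D] are the coefficients of [D] in the powers of [L], because [e] separates
     the operators commuting with [L]. *)
  have DP : D = P_check L x p.
    apply: (covec_inj (coframe x Ux) (MR x Ux)) => //.
      by apply: central_lincomb => k; exact: central_pow.
    rewrite pE /P_check mulmx_sumr; apply: eq_bigr => k _.
    by rewrite scalemxAr.
  rewrite (hM x (df x *m D) p Ux) -?DP; first exact: expr2.
  by rewrite /canonical_momenta pE; apply: eq_bigr => k _; rewrite du_coframeE.
split=> [x Ux|i x Ux].
  exact: (@T0_unit _ _ L x (df x) (coframe x Ux) (M^~ x) (fun i => R_op L C i x)
    (MR x Ux) (fun i => h i x) (g x) (fun D => hE x D Ux) (g_metric x Ux).1
    (g_metric x Ux).2 (fun xi => h0 x xi Ux)).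
exact: (@K_lam _ _ L x (df x) (coframe x Ux) (M^~ x) (fun i => R_op L C i x)
  (MR x Ux) (fun i => h i x) (g x) (K^~ x) (fun D => hE x D Ux) (g_metric x Ux).1
  (g_metric x Ux).2 (fun xi => h0 x xi Ux) (fun i xi eta => K_adj i x xi eta Ux)
  (fun i xi => hi i x xi Ux) i).
Qed.

End Assembly.

Theorem theorem6p1 (R : realType) (n : nat) (U : set 'rV[R]_n.+1)
  (L : 'rV[R]_n.+1 -> 'M[R]_n.+1)
  (M : 'I_n.+1 -> 'rV[R]_n.+1 -> 'M[R]_n.+1)
  (C : 'rV[R]_n.+1 -> 'M[R]_n.+1)
  (df : 'rV[R]_n.+1 -> 'rV[R]_n.+1)
  (h : 'I_n.+1 -> 'rV[R]_n.+1 -> 'rV[R]_n.+1 -> R)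
  (g : 'rV[R]_n.+1 -> 'M[R]_n.+1)
  (K : 'I_n.+1 -> 'rV[R]_n.+1 -> 'M[R]_n.+1)
  (U_open : open U)
  (L_nijenhuis : nijenhuis U L)
  (L_regular : gl_regular U L)
  (M_basis : Sym_basis U L M)
  (C_def : forall i x, U x -> M i x = \sum_(j < n.+1) C x i j *: L x ^+ (n - j))
  (df_regular : regular_conservation_law U L df)
  (K_def : killing_tensors U L M df h g K) :
  (forall x, U x -> C x \in unitmx) /\
  (* 1 *)
  ((forall x, U x -> R_op L C ord0 x \in unitmx) /\
   (forall i x, U x -> K i x = R_op L C i x *m invmx (R_op L C ord0 x)) /\
   (forall df' h' g' K', regular_conservation_law U L df' ->
      killing_tensors U L M df' h' g' K' ->
      forall i x, U x -> K' i x = K i x)) /\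
  (* 2 *)
  ((forall i j, symmetries U (K i) (K j)) /\
   (forall i, haantjes U (K i))) /\
  (* 3 *)
  ((forall (N : 'rV[R]_n.+1 -> 'M[R]_n.+1) (c : 'I_n.+1 -> 'rV[R]_n.+1 -> R),
      Sym U L N ->
      (forall x, U x -> N x = \sum_i c i x *: M i x) ->
      (forall i, smooth U (c i)) /\
      (forall i x, U x ->
         dual_app (K i) (differential (c ord0)) x = differential (c i) x) /\
      (forall i, conservation_law U (K i) (differential (c ord0)))) /\
   (forall beta : 'rV[R]_n.+1 -> 'rV[R]_n.+1,
      (forall i, conservation_law U (K i) beta) ->
      forall x0, U x0 -> exists V : set 'rV[R]_n.+1,
        [/\ open V, V x0, V `<=` U &
         exists (N : 'rV[R]_n.+1 -> 'M[R]_n.+1)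
                (c : 'I_n.+1 -> 'rV[R]_n.+1 -> R),
           [/\ Sym V L N,
               forall x, V x -> N x = \sum_i c i x *: M i x &
               forall x, V x -> beta x = differential (c ord0) x]])) /\
  (* 4 *)
  ((forall (dr : 'rV[R]_n.+1 -> 'rV[R]_n.+1) (r : 'I_n.+1 -> 'rV[R]_n.+1 -> R),
      conservation_law U L dr ->
      (forall k, smooth U (r k)) ->
      (forall k x, U x -> differential (r k) x = dual_app (M k) dr x) ->
      forall i, symmetries U (K i) (fun x => \sum_k r k x *: K k x)) /\
   (forall S : 'rV[R]_n.+1 -> 'M[R]_n.+1,
      (forall i, symmetries U (K i) S) ->
      forall x0, U x0 -> exists V : set 'rV[R]_n.+1,
        [/\ open V, V x0, V `<=` U &
         exists (r0 : 'rV[R]_n.+1 -> R) (r : 'I_n.+1 -> 'rV[R]_n.+1 -> R),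
           [/\ smooth V r0,
               conservation_law V L (differential r0),
               forall k, smooth V (r k),
               forall k x, V x ->
                 differential (r k) x = dual_app (M k) (differential r0) x &
               forall x, V x -> S x = \sum_k r k x *: K k x]])).
Proof.
have [symM _] := M_basis.
have C_unit := basis_matrix_unit M_basis C_def.
have [R0_unit KE] := killing_R M_basis C_def df_regular K_def.
have [[[sdf _] _] _] := df_regular.
have coframe x (Ux : U x) := regular_coframe_unit df_regular Ux.
split; first exact: C_unit.
split.
  split; first exact: R0_unit.
  split; first exact: KE.
  (* Both families are the same expression in the [R_op], which are built from [L] and [C] alone. *)
  move=> df' h' g' K' df'_regular K'_def i x Ux.
  by have [_ ->] := killing_R M_basis C_def df'_regular K'_def; rewrite // KE.
split.
  split=> [i j|i].
    exact: (K_symmetries U_open L_nijenhuis sdf coframe symM C_unit C_def R0_unit KE).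
  apply: (central_haantjes U_open L_nijenhuis sdf coframe).
    exact: (smooth_K U_open L_nijenhuis sdf coframe symM C_unit C_def R0_unit KE).
  by move=> x Ux; exact: (K_central R0_unit KE i Ux).
split.
  split=> [N c symN NE|beta beta_cl x0 Ux0].
    split.
      exact: (Sym_coef_smooth U_open L_nijenhuis sdf coframe symM C_unit C_def symN NE).
    split=> [i x Ux|i].
      exact: (Sym_coef_K U_open L_nijenhuis sdf coframe symM C_unit C_def R0_unit KE
        symN NE).
    exact: (Sym_coef_conservation U_open L_nijenhuis sdf coframe symM C_unit C_def
      R0_unit KE symN NE).
  exact: (conservation_Sym U_open L_nijenhuis coframe symM C_unit C_def R0_unit KE
    beta_cl Ux0).
split=> [dr r dr_cl sr drE i|S symS x0 Ux0].
  exact: (conservation_symmetries U_open L_nijenhuis sdf coframe symM C_unit C_def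
    R0_unit KE i sr drE).
exact: (symmetry_conservation U_open L_nijenhuis sdf coframe symM C_unit C_def
  R0_unit KE symS Ux0).
Qed.
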